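(* Assume that $1<q\le p\le\infty$, $0<\gamma<\frac{d}{q}$ and $-\frac{d}{q}\le\beta<-\gamma$. Let $\phi\in\mathcal{G}_{q,p}$ be such that there is a constant $C>0$ with $$\int_{r}^{\infty}\phi^{q}(t)\,t^{\frac{dq}{p}-1}\,dt\le C\,\phi^{q}(r)\,r^{\frac{dq}{p}}\quad\text{for every } r>0,$$ and such that there is a constant $C'>0$ with $\phi(r)\le C' r^{\beta}$ for every $r>0$. Put $s=-\frac{\beta q}{\gamma}$ and $l=-\frac{\beta p}{\gamma}$ (so $l=\infty$ if $p=\infty$). Then there is a constant $K>0$ such that for all $W\in(L^{s},L^{l})^{\phi^{q/s}}(\mathbb{R}^{d})$ and all $f\in(L^{q},L^{p})^{\phi}(\mathbb{R}^{d})$, $$\|W\cdot I_{\gamma}f\|_{(L^{q},L^{p})^{\phi}(\mathbb{R}^{d})}\le K\,\|W\|_{(L^{s},L^{l})^{\phi^{q/s}}(\mathbb{R}^{d})}\,\|f\|_{(L^{q},L^{p})^{\phi}(\mathbb{R}^{d})}.$$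
   Context: Convention: $\frac1\infty=0$. $L^{0}(\mathbb{R}^{d})$ is the space of (a.e. equivalence classes of) Lebesgue measurable complex-valued functions on $\mathbb{R}^d$; $B(y,r)$ is the open ball with center $y\in\mathbb{R}^d$ and radius $r>0$. For $1\le q\le p\le\infty$, $\mathcal{G}_{q,p}$ is the set of all functions $\phi:(0,\infty)\to(0,\infty)$ such that $t\mapsto\phi(t)t^{d/p}$ is almost decreasing (there is $C>0$ with $\phi(s)s^{d/p}\le C\phi(r)r^{d/p}$ whenever $0<r\le s<\infty$) and $t\mapsto\phi(t)t^{d/q}$ is almost increasing (there is $C>0$ with $\phi(r)r^{d/q}\le C\phi(s)s^{d/q}$ whenever $0<r\le s<\infty$). For $r>0$ and $f\in L^0(\mathbb{R}^d)$, put ${}_{r}\|f\|_{q,p}=\left\|\left[\int_{\mathbb{R}^d}|f\chi_{B(y,r)}|^{q}(x)\,dx\right]^{1/q}\right\|_{p}$, the $L^{p}(\mathbb{R}^d)$-norm being taken in the variable $y$ (usual modification if $q=\infty$). For $\phi\in\mathcal{G}_{q,p}$ the generalized Fofana space $(L^{q},L^{p})^{\phi}(\mathbb{R}^{d})$ is the set of all $f\in L^{0}(\mathbb{R}^{d})$ with $$\|f\|_{(L^{q},L^{p})^{\phi}(\mathbb{R}^{d})}=\sup_{r>0}\frac{1}{\phi(r)}\,r^{d(-\frac1q-\frac1p)}\;{}_{r}\|f\|_{q,p}<\infty.$$ For $0<\gamma<d$, the Riesz potential (fractional integral operator) is $I_{\gamma}f(x)=\int_{\mathbb{R}^{d}}\frac{f(y)}{|x-y|^{d-\gamma}}\,dy$,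 $x\in\mathbb{R}^d$. Here $\phi^{q/s}$ denotes the function $r\mapsto(\phi(r))^{q/s}$, and $W\cdot I_\gamma f$ is the pointwise product. *)

(* Defs.v *)
From HB Require Import structures.
From mathcomp Require Import all_boot all_order all_algebra.
From mathcomp Require Import all_classical all_reals all_analysis.
From mathcomp Require Import complex.

Set Implicit Arguments.
Unset Strict Implicit.
Unset Printing Implicit Defensive.

Import Order.TTheory GRing.Theory Num.Theory.
Import numFieldNormedType.Exports.

Local Open Scope classical_set_scope.
Local Open Scope ring_scope.

(* [d.-tuple R] carries the product (= Borel) sigma-algebra of R^d.  The Borel
   measure is built by recursion on d, from a point mass on R^0, by identifying
   R^(n.+1) with R * R^n. *)

Section cons_measure.
Context {R : realType} (n : nat).

Definition cons_tuple (u : measurableTypeR R * n.-tuple (measurableTypeR R)) :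
  n.+1.-tuple (measurableTypeR R) := [tuple of u.1 :: u.2].

Lemma measurable_cons_tuple : measurable_fun [set: _] cons_tuple.
Proof. exact: measurable_cons. Qed.

Variable mu :
  {sigma_finite_measure set (n.-tuple (measurableTypeR R)) -> \bar R}.

Definition cons_measure : set (n.+1.-tuple (measurableTypeR R)) -> \bar R :=
  pushforward (@lebesgue_measure R \x mu)%E cons_tuple.

Let cons_measure0 : cons_measure set0 = 0%E.
Proof. by rewrite /cons_measure /pushforward preimage_set0 measure0. Qed.

Let cons_measure_ge0 A : (0 <= cons_measure A)%E.
Proof. by rewrite /cons_measure /pushforward measure_ge0. Qed.

Let cons_measure_sigma_additive : semi_sigma_additive cons_measure.
Proof.
exact: (@measure_semi_sigma_additive _ _ _
  (measure_function_pushforward__canonical__measure_function_Measure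
    (@lebesgue_measure R \x mu)%E measurable_cons_tuple)).
Qed.

HB.instance Definition _ := isMeasure.Build _ _ _ cons_measure
  cons_measure0 cons_measure_ge0 cons_measure_sigma_additive.

Lemma cons_measure_sigma_finite : sigma_finite [set: _] cons_measure.
Proof.
have /sigma_finiteP[F [TF ndF Foo]] := sigma_finiteT (@lebesgue_measure R).
have /sigma_finiteP[G [TG ndG Goo]] := sigma_finiteT mu.
exists (fun k => [set t : n.+1.-tuple _ | F k (thead t)] `&`
                 [set t : n.+1.-tuple _ | G k [tuple of behead t]]).
  rewrite predeqE => t; split=> // _.
  have [i _ Fi] : (\bigcup_i F i) (thead t) by rewrite -TF.
  have [j _ Gj] : (\bigcup_j G j) [tuple of behead t] by rewrite -TG.
  exists (maxn i j) => //; split.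
    by have /subsetPset := ndF _ _ (leq_maxl i j); exact.
  by have /subsetPset := ndG _ _ (leq_maxr i j); exact.
move=> k; have [mF Fk] := Foo k; have [mG Gk] := Goo k; split.
  apply: measurableI; rewrite -[X in measurable X]setTI.
    exact: (measurable_tnth ord0).
  exact: measurable_behead.
rewrite /cons_measure /pushforward (_ : _ @^-1` _ = F k `*` G k); last first.
  have tlK x t : [tuple of behead (cons_tuple (x, t))] = t by exact/val_inj.
  by rewrite predeqE => -[x t]; split=> -[]; rewrite /= tlK.
by rewrite product_measure1E// lte_mul_pinfty// ge0_fin_numE.
Qed.

HB.instance Definition _ := @Measure_isSigmaFinite.Build _ _ _
  cons_measure cons_measure_sigma_finite.

End cons_measure.

Fixpoint borel_lebesgue {R : realType} (d : nat) :
    {sigma_finite_measure set (d.-tuple (measurableTypeR R)) -> \bar R} :=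
  if d is n.+1 then cons_measure (borel_lebesgue n) else \d_[tuple].

Lemma borel_lebesgue_box (R : realType) (d : nat)
    (A : 'I_d -> set (measurableTypeR R)) : (forall i, measurable (A i)) ->
  borel_lebesgue d [set t | forall i, A i (tnth t i)] =
  (\prod_(i < d) lebesgue_measure (A i))%E.
Proof.
elim: d A => [|d IH] A mA.
  rewrite big_ord0 /= diracE mem_set//= => -[].
  by [].
rewrite big_ord_recl/= -IH//.
rewrite /cons_measure /pushforward (_ : _ @^-1` _ = A ord0 `*`
   [set t | forall i : 'I_d, A (lift ord0 i) (tnth t i)]); last first.
  rewrite predeqE => -[x t]; split=> /=.
    move=> h; split; first by have := h ord0.
    by move=> i; have := h (lift ord0 i); rewrite tnthS.
  move=> [h0 h] i.
  case: (unliftP ord0 i) => [j|] -> //.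
  by rewrite tnthS.
rewrite product_measure1E//.
rewrite (_ : mkset _ = \bigcap_(i in [set: 'I_d]) ((fun t => tnth t i) @^-1` A (lift ord0 i))).
  apply: fin_bigcap_measurable => // i _; rewrite -[X in measurable X]setTI.
  exact: measurable_tnth.
by rewrite predeqE => t; split=> /= [h i _|h i]; [exact: h|exact: (h i I)].
Qed.

(* R^d with the sigma-algebra of Lebesgue (Caratheodory) measurable sets; as in
   the one-dimensional [completed_lebesgue_measure]. *)
Definition Rd (R : realType) (d : nat) : Type :=
  caratheodory_type ((@borel_lebesgue R d)^*)%mu.

Definition lebesgue_measure_Rd {R : realType} {d : nat} : set (Rd R d) -> \bar R :=
  @completed_measure_extension _ _ _ (@borel_lebesgue R d).

HB.instance Definition _ (R : realType) (d : nat) :=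
  Measure.on (@lebesgue_measure_Rd R d).

Lemma lebesgue_measure_Rd_borel (R : realType) (d : nat)
    (A : set (d.-tuple (measurableTypeR R))) : measurable A ->
  lebesgue_measure_Rd (A : set (Rd R d)) = borel_lebesgue d A.
Proof. by move=> mA; exact: measurable_mu_extE. Qed.

Definition coord {R : realType} {d : nat} (x : Rd R d) (i : 'I_d) : R :=
  tnth (x : d.-tuple R) i.

Definition edist {R : realType} {d : nat} (x y : Rd R d) : R :=
  Num.sqrt (\sum_(i < d) (coord x i - coord y i) ^+ 2).

Definition eball {R : realType} {d : nat} (y : Rd R d) (r : R) : set (Rd R d) :=
  [set x | edist x y < r].

(* Elements of L^0(R^d) are represented by functions: the norms below do not
   change under modification on a null set. *)
Definition L0 {R : realType} {d : nat} (f : Rd R d -> R[i]) : Prop :=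
  measurable_fun [set: Rd R d] (fun x => complex.Re (f x)) /\
  measurable_fun [set: Rd R d] (fun x => complex.Im (f x)).

(* 1 / p with the convention 1 / oo = 0 *)
Definition recip {R : realType} (p : \bar R) : R := fine p^-1%E.

Definition almost_decreasing {R : realType} (g : R -> R) : Prop :=
  exists2 C : R, 0 < C & forall r s : R, 0 < r -> r <= s -> g s <= C * g r.

Definition almost_increasing {R : realType} (g : R -> R) : Prop :=
  exists2 C : R, 0 < C & forall r s : R, 0 < r -> r <= s -> g r <= C * g s.

(* Functions on (0, oo) are represented by functions on R of which only the
   values at positive arguments matter. *)
Definition classG {R : realType} (d : nat) (q p : \bar R) (phi : R -> R) : Prop :=
  [/\ forall r, 0 < r -> 0 < phi r,
      almost_decreasing (fun t => phi t * t `^ (d%:R * recip p)) &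
      almost_increasing (fun t => phi t * t `^ (d%:R * recip q))].

Section fofana.
Context {R : realType} {d : nat}.
Implicit Types (q p : \bar R) (phi : R -> R) (f : Rd R d -> R[i]).
Local Open Scope ereal_scope.

Definition local_norm q p (r : R) f : \bar R :=
  Lnorm lebesgue_measure_Rd p (fun y : Rd R d =>
    Lnorm lebesgue_measure_Rd q (fun x : Rd R d =>
      (Normc.normc (f x) * \1_(eball y r) x)%:E)).

Definition fofana_norm q p phi f : \bar R :=
  ereal_sup [set ((phi r)^-1 * r `^ (d%:R * (- recip q - recip p)))%:E
                   * local_norm q p r f | r in [set r : R | (0 < r)%R]].

Definition fofana_space q p phi : set (Rd R d -> R[i]) :=
  [set f | L0 f /\ fofana_norm q p phi f < +oo].

End fofana.

(* The integral of a complex-valued function is taken componentwise.  At a point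
   x where it does not converge absolutely its value here is meaningless; for f
   in the spaces considered such x form a null set.  The value of the kernel at
   y = x is irrelevant as well, since {x} is a null set. *)
Definition riesz_potential {R : realType} {d : nat} (gamma : R)
    (f : Rd R d -> R[i]) (x : Rd R d) : R[i] :=
  Complex
    (\int[lebesgue_measure_Rd]_(y in [set: Rd R d])
       (complex.Re (f y) / edist x y `^ (d%:R - gamma)))
    (\int[lebesgue_measure_Rd]_(y in [set: Rd R d])
       (complex.Im (f y) / edist x y `^ (d%:R - gamma))).

(* Main.v *)
From HB Require Import structures.
Require Import Defs.
From mathcomp Require Import all_boot all_order all_algebra.
From mathcomp Require Import all_classical all_reals all_analysis.
From mathcomp Require Import complex.
From mathcomp Require Import measurable_realfun ess_sup_inf ring lra.

Set Implicit Arguments.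
Unset Strict Implicit.
Unset Printing Implicit Defensive.

Import Order.TTheory GRing.Theory Num.Theory.
Import numFieldNormedType.Exports.

Local Open Scope classical_set_scope.
Local Open Scope ring_scope.

(* Normalise so that f and W have norm 1, and write th = - gamma / beta,
   v = q / (1 - th), s = q / th.  The bound phi r <= C' r ^ beta gives the Morrey bound
   int_B(x, r) |f| <= A r ^ (d + beta), hence a pointwise estimate
     (I_gamma |f| x) ^ v <= C int |x - z| ^ (gamma - d) |f z|
                           min (|x - z| ^ (gamma + beta), |f z| ^ (1 - th)) ^ (v - 1) dz,
   whose integral in x is at most C int |f| ^ q by Tonelli; this replaces the
   boundedness of the maximal function.  Applied to the part of f near a ball B(y, r), and
   with a direct estimate of the far part, it bounds int_B(y, r) (I_gamma |f|) ^ v by the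
   largest of 2 ^ (- k d) int_B(y, 2 ^ k r) |f| ^ q.  Since
   (|W| I_gamma |f|) ^ q <= |W| ^ s + (I_gamma |f|) ^ v, it remains to take the norm in y
   and to sum over k; the integral condition on phi makes the sum converge. *)

(** * Preliminaries *)

(** The exponents satisfy [1 / q = th / q + 1 / v] and [beta * (1 - th) = gamma + beta]. The first
    identity fits the weight to the problem: since [phi ^ (q / s) = phi ^ th], normalised [|W| ^ s]
    and [|f| ^ q] obey the same bounds on balls. By the second, the near and the far part of the
    potential balance at a single radius. The obstacle that shapes the statements is that
    [I_gamma f] has a meaningless value where its integral diverges, and that its measurability is
    not established. It therefore enters only as some function [j >= 0] lying below a potential with
    values in [0, +oo]. Each number [lam] below the potential is estimated separately, integrals are
    added only for measurable majorants, and the product [W * I_gamma f] is handled by monotonicity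
    and homogeneity of the lower integral. The estimates use only the measure of balls, a weak
    triangle inequality and joint measurability of the distance; they are proved for an abstract
    space in which [e] stands for the dimension and [c] for the constant of ball regularity. *)

Section lower_integral.
Context {disp} {T : measurableType disp} {R : realType}.
Variable mu : {measure set T -> \bar R}.
Local Open Scope ereal_scope.

(* The integral of a nonnegative function is a supremum over the simple functions
   below it, hence monotone even without measurability. *)
Lemma le_lower_integral (D : set T) (f1 f2 : T -> \bar R) :
  (forall x, D x -> 0 <= f1 x) -> (forall x, D x -> f1 x <= f2 x) ->
  \int[mu]_(x in D) f1 x <= \int[mu]_(x in D) f2 x.
Proof.
move=> f10 f12.
have f20 x : D x -> 0 <= f2 x by move=> Dx; exact: le_trans (f10 _ Dx) (f12 _ Dx).
rewrite !ge0_integralE//; apply: ge_ereal_sup => _ [h/= hf] <-.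
apply: ereal_sup_ubound; exists h => // x; apply: le_trans (hf x) _.
by rewrite /patch; case: ifPn => // /set_mem; exact: f12.
Qed.

Import HBNNSimple.

(** Dividing a simple function below [k * f] by [k] gives one below [f], whether or not [f] is
    measurable. *)
Let lower_integralZl_le (k : R) (f : T -> \bar R) : (0 < k)%R -> (forall x, 0 <= f x) ->
  \int[mu]_x (k%:E * f x) <= k%:E * \int[mu]_x f x.
Proof.
move=> k0 f0; have kf0 x : 0 <= k%:E * f x by rewrite mule_ge0// lee_fin ltW.
have ki : (0 <= k^-1)%R by rewrite invr_ge0 ltW.
rewrite !ge0_integralTE//; apply: ge_ereal_sup => _ [h/= hf] <-.
have -> : sintegral mu h = k%:E * sintegral mu (scale_nnsfun h ki).
  by rewrite sintegralrM muleA -EFinM divff ?gt_eqF// mul1e.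
rewrite lee_pmul2l ?lte_fin//; apply: ereal_sup_ubound.
exists (scale_nnsfun h ki) => // x /=.
by rewrite EFinM lee_pdivrMl//; exact: hf.
Qed.

(** The reverse inequality is the preceding one for the function [k * f] and the factor [k^-1]. *)
Lemma lower_integralZl (k : R) (f : T -> \bar R) : (0 < k)%R -> (forall x, 0 <= f x) ->
  \int[mu]_x (k%:E * f x) = k%:E * \int[mu]_x f x.
Proof.
move=> k0 f0; apply/eqP; rewrite eq_le lower_integralZl_le//=.
have ki : (0 < k^-1)%R by rewrite invr_gt0.
have kf0 x : 0 <= k%:E * f x by rewrite mule_ge0// lee_fin ltW.
have := lower_integralZl_le ki kf0.
under eq_integral do rewrite muleA -EFinM mulVf ?gt_eqF// mul1e.
by rewrite lee_pdivlMl.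
Qed.

End lower_integral.

Section powers.
Context {R : realType}.
Implicit Types x y a b : R.

Lemma powRD_gt0 x a b : 0 < x -> x `^ (a + b) = x `^ a * x `^ b.
Proof. by move=> x0; apply: powRD; apply/implyP => _; rewrite gt_eqF. Qed.

Lemma powRrV x a : a != 0 -> 0 <= x -> (x `^ a^-1) `^ a = x.
Proof. by move=> a0 x0; rewrite -powRrM mulVf// powRr1. Qed.

Lemma powR_exprn x n a : 0 <= x -> (x ^+ n) `^ a = (x `^ a) ^+ n.
Proof.
by move=> x0; rewrite -powR_mulrn// powRAC powR_mulrn// powR_ge0.
Qed.

Lemma gt0_ler_powR x y a : 0 < x -> x <= y -> 0 <= a -> x `^ a <= y `^ a.
Proof.
move=> x0 xy a0; apply: ge0_ler_powR => //; rewrite nnegrE ltW//.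
exact: lt_le_trans xy.
Qed.

Lemma lt0_ger_powR x y a : 0 < x -> x <= y -> a <= 0 -> y `^ a <= x `^ a.
Proof.
move=> x0 xy a0; have y0 := lt_le_trans x0 xy.
rewrite -(opprK a) !(powRN _ (- a)) lef_pV2 ?posrE ?powR_gt0//.
by apply: gt0_ler_powR => //; rewrite oppr_ge0.
Qed.

Lemma powR_lt1 x a : 0 < x -> x < 1 -> 0 < a -> x `^ a < 1.
Proof.
move=> x0 x1 a0; have -> : 1 = 1 `^ a :> R by rewrite powR1.
by apply: gt0_ltr_powR => //; rewrite nnegrE ?ltW.
Qed.

Lemma powR_gt1_lt1 x a : 1 < x -> a < 0 -> x `^ a < 1.
Proof.
move=> x1 a0; have x0 := lt_trans ltr01 x1.
rewrite -(invrK x) -(powR_inv1 (ltW _)) ?invr_gt0// -powRrM mulN1r.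
by rewrite powR_lt1 ?invr_gt0// ?invf_lt1// oppr_gt0.
Qed.

Lemma nneseries_geometric (a z : R) : 0 <= a -> 0 <= z < 1 ->
  (\sum_(k <oo) (a * z ^+ k)%:E)%E = (a / (1 - z))%:E.
Proof.
move=> a0 /andP[z0 z1].
rewrite (_ : (fun n => _) = EFin \o series (geometric a z)); last first.
  by apply/funext => n /=; rewrite sumEFin.
have z_lt1 : `|z| < 1 by rewrite ger0_norm.
rewrite EFin_lim; last exact: is_cvg_geometric_series.
by congr EFin; apply/cvg_lim => //; exact: cvg_geometric_series.
Qed.

Lemma nneseries_ge_term (u : nat -> \bar R) k : (forall n, 0 <= u n)%E ->
  (u k <= \sum_(n <oo) u n)%E.
Proof.
move=> u0; apply: (@le_trans _ _ (\sum_(0 <= i < k.+1) u i)%E).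
  by rewrite big_nat_recr//= leeDr// sume_ge0.
by apply: nneseries_lim_ge => n _ _; exact: u0.
Qed.

End powers.

(** * Potentials on regular quasi-metric spaces *)

Section quasi_metric_space.
Context {disp} {T : measurableType disp} {R : realType}.
Implicit Types (D : T -> T -> R) (y : T) (r : R).

Definition qball D y r : set T := [set x | D x y < r].

(* The weak triangle inequality holds for the Euclidean distance without appeal to
   Cauchy-Schwarz. *)
Record regular_quasi_metric (mu : {measure set T -> \bar R}) D (e c : R) : Prop := {
  qm_dim_gt0 : 0 < e ;
  qm_cst_gt0 : 0 < c ;
  qm_ge0 : forall x y, 0 <= D x y ;
  qm_sym : forall x y, D x y = D y x ;
  qm_triangle : forall x y z, D x z <= 2 * Num.max (D x y) (D y z) ;
  qm_measurable : measurable_fun [set: T * T] (fun u => D u.1 u.2) ;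
  qm_ball_le : forall y r, 0 < r -> (mu (qball D y r) <= (c * r `^ e)%:E)%E ;
  qm_ball_ge : forall y r, 0 < r -> ((c^-1 * r `^ e)%:E <= mu (qball D y r))%E
}.

End quasi_metric_space.

(** * Shell decomposition of potentials *)

Section potential.
Context {disp} {T : measurableType disp} {R : realType}.
Variables (mu : {sigma_finite_measure set T -> \bar R}) (D : T -> T -> R) (e c : R).
Hypothesis qm : regular_quasi_metric mu D e c.
Implicit Types (g : T -> R) (x y z : T) (r : R).

Local Notation B := (qball D).

Lemma measurable_dist (d' : measure_display) (S : measurableType d') (h1 h2 : S -> T) :
  measurable_fun [set: S] h1 -> measurable_fun [set: S] h2 ->
  measurable_fun [set: S] (fun u => D (h1 u) (h2 u)).
Proof.
move=> m1 m2; apply: (@measurableT_comp _ _ _ _ _ _ (fun u : T * T => D u.1 u.2) _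
  (fun u => (h1 u, h2 u))); first exact: qm_measurable qm.
exact: measurable_fun_pair.
Qed.

Lemma measurable_qball y r : measurable (B y r).
Proof.
rewrite /qball (_ : mkset _ = [set: T] `&` (fun x => D x y) @^-1` `]-oo, r[).
  by apply: measurable_dist => //; exact: measurable_itv.
by apply/seteqP; split=> x /=; rewrite in_itv/=; [split|case].
Qed.

Lemma measurable_qball_ind y r : measurable_fun [set: T] (\1_(B y r) : T -> R).
Proof. exact/measurable_indic/measurable_qball. Qed.

Lemma qball_indE x y r : \1_(B y r) x = (D x y < r)%R%:R :> R.
Proof. by rewrite indicE; congr (_%:R); congr nat_of_bool; apply/asboolP/idP. Qed.

Lemma measurable_dist_pow x a : measurable_fun [set: T] (fun z => D z x `^ a).
Proof. by apply: (measurableT_comp (measurable_powR a)); apply: measurable_dist. Qed.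

Lemma measurable_kernel_ind a y g (X : set T) :
  measurable_fun [set: T] g -> measurable X ->
  measurable_fun [set: T] (fun z => (D z y `^ a * (g z * \1_X z))%:E).
Proof.
move=> mg mX; apply/measurable_EFinP/measurable_funM; first exact: measurable_dist_pow.
by apply: measurable_funM => //; exact: measurable_indic.
Qed.

(** Norms enter the estimates only through this quantity: for [g = h ^ q] it is the [q]-th power of
    the inner norm of [h] over the ball. *)
Definition mass g y r : \bar R := (\int[mu]_x (g x * \1_(B y r) x)%:E)%E.

Lemma measurable_integrand g y r : measurable_fun [set: T] g ->
  measurable_fun [set: T] (fun x => (g x * \1_(B y r) x)%:E).
Proof.
by move=> mg; apply/measurable_EFinP/measurable_funM => //; exact: measurable_qball_ind.
Qed.

Lemma mass_ge0 g y r : (forall x, 0 <= g x) -> (0 <= mass g y r)%E.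
Proof. by move=> g0; apply: integral_ge0 => x _; rewrite lee_fin mulr_ge0. Qed.

Lemma mass_cst a y r : 0 <= a -> mass (cst a) y r = (a%:E * mu (B y r))%E.
Proof.
move=> a0; rewrite /mass; under eq_integral do rewrite EFinM.
rewrite ge0_integralZl_EFin//.
- by rewrite integral_indic ?setIT//; exact: measurable_qball.
- by apply/measurable_EFinP; exact: measurable_qball_ind.
Qed.

(* Decompose X into the shells rho t^k <= D x y < 2 rho t^k. *)
Lemma shell_potential_le (a b A rho t : R) g y (X : set T) :
  a < 0 -> 0 <= A -> 0 < rho -> 0 < t -> t `^ (a + b) < 1 ->
  measurable_fun [set: T] g -> (forall x, 0 <= g x) ->
  (forall x, X x -> 0 < D x y -> exists k, rho * t ^+ k <= D x y < 2 * (rho * t ^+ k)) ->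
  (forall k, mass g y (2 * (rho * t ^+ k)) <= (A * (2 * (rho * t ^+ k)) `^ b)%:E)%E ->
  (\int[mu]_x (D x y `^ a * (g x * \1_X x))%:E
     <= (A * (2 `^ b / (1 - t `^ (a + b))) * rho `^ (a + b))%:E)%E.
Proof.
move=> a0 A0 rho0 t0 tab1 mg g0 shells massg.
pose p k := rho * t ^+ k.
have p0 k : 0 < p k by rewrite mulr_gt0// exprn_gt0.
pose f k x := (p k `^ a * (g x * \1_(B y (2 * p k)) x))%:E.
have f0 k x : (0 <= f k x)%E by rewrite lee_fin !mulr_ge0// powR_ge0.
have mf k : measurable_fun [set: T] (f k).
  apply/measurable_EFinP; apply: measurable_funM => //.
  by apply/measurable_EFinP; exact: measurable_integrand.
apply: (@le_trans _ _ (\int[mu]_x (\sum_(k <oo) f k x))%E).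
  apply: le_lower_integral => x _.
    by rewrite lee_fin !mulr_ge0// powR_ge0.
  have [Xx|nXx] := pselect (X x); last first.
    rewrite indicE memNset// !mulr0; apply: nneseries_ge0 => k _ _; exact: f0.
  (* At the centre the kernel is a negative power of zero, which [powR] sets to zero, so the shells
     need only cover points at positive distance. *)
  have := qm_ge0 qm x y; rewrite le_eqVlt => /predU1P[<-|Dxy0].
    rewrite powR0 ?lt_eqF// mul0r; apply: nneseries_ge0 => k _ _; exact: f0.
  have [k /andP[kx xk]] := shells x Xx Dxy0.
  apply: le_trans (nneseries_ge_term k (fun n => f0 n x)).
  rewrite /f lee_fin qball_indE xk indicE mem_set// mulr1.
  by rewrite ler_wpM2r// lt0_ger_powR// ltW.
rewrite integral_nneseries//.
(* The shell [k] contributes at most [p k ^ a * A * (2 * p k) ^ b], a geometric sequence of ratio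
   [t ^ (a + b) < 1]. *)
apply: (@le_trans _ _
    (\sum_(k <oo) (A * 2 `^ b * rho `^ (a + b) * (t `^ (a + b)) ^+ k)%:E)%E).
  apply: lee_nneseries => [k _ _|k _].
    by apply: integral_ge0 => x _; exact: f0.
  rewrite /f; under eq_integral do rewrite EFinM.
  rewrite ge0_integralZl_EFin ?powR_ge0//; last 2 first.
    by move=> x _; rewrite lee_fin mulr_ge0.
    exact: measurable_integrand.
  apply: (@le_trans _ _ ((p k `^ a)%:E * (A * (2 * p k) `^ b)%:E)%E).
    by rewrite lee_pmul2l ?lte_fin ?powR_gt0//; exact: massg.
  have E : p k `^ a * p k `^ b = rho `^ (a + b) * (t `^ (a + b)) ^+ k.
    by rewrite -powRD_gt0// powRM ?ltW ?exprn_gt0// powR_exprn ?ltW.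
  rewrite -EFinM lee_fin (powRM _ (ler0n _ 2) (ltW (p0 k))) le_eqVlt; apply/orP; left; apply/eqP.
  by transitivity (A * 2 `^ b * (p k `^ a * p k `^ b)); [ring|rewrite E; ring].
rewrite nneseries_geometric; last 2 first.
  by rewrite !mulr_ge0 ?powR_ge0.
  by rewrite powR_ge0.
by rewrite lee_fin le_eqVlt; apply/orP; left; apply/eqP; ring.
Qed.

End potential.

Section dyadic.
Context {R : realType}.

Lemma dyadic_shell_ge1 (x : R) : 1 <= x -> exists k : nat, 2 ^+ k <= x < 2 * 2 ^+ k.
Proof.
move=> x1; have hex : exists k : nat, x < 2 ^+ k.+1.
  exists (Num.bound x); apply: (lt_trans (archi_boundP (le_trans ler01 x1))).
  rewrite -natrX ltr_nat; apply: (@ltn_trans (2 ^ Num.bound x)); first exact: ltn_expl.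
  by rewrite ltn_exp2l.
have [k xk kmin] := ex_minnP hex; exists k; rewrite -exprS xk andbT.
case: k xk kmin => [|k] _ kmin; first by rewrite expr0.
by rewrite leNgt; apply/negP => /kmin; rewrite ltnn.
Qed.

(** Shells near the centre are found from the inverse ratio [r / D x y]; inversion exchanges strict
    and weak inequalities, hence this variant closed on the right. *)
Lemma dyadic_shell_gt1 (x : R) : 1 < x -> exists k : nat, 2 ^+ k < x <= 2 * 2 ^+ k.
Proof.
move=> x1; have hex : exists k : nat, x <= 2 ^+ k.+1.
  exists (Num.bound x); apply/ltW/(lt_trans (archi_boundP (le_trans ler01 (ltW x1)))).
  rewrite -natrX ltr_nat; apply: (@ltn_trans (2 ^ Num.bound x)); first exact: ltn_expl.
  by rewrite ltn_exp2l.
have [k xk kmin] := ex_minnP hex; exists k; rewrite -exprS xk andbT.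
case: k xk kmin => [|k] _ kmin; first by rewrite expr0.
by rewrite ltNge; apply/negP => /kmin; rewrite ltnn.
Qed.

End dyadic.

Section near_far.
Context {disp} {T : measurableType disp} {R : realType}.
Variables (mu : {sigma_finite_measure set T -> \bar R}) (D : T -> T -> R) (e c : R).
Hypothesis qm : regular_quasi_metric mu D e c.
Implicit Types (g : T -> R) (x y z : T) (r : R).

Local Notation B := (qball D).
Local Notation mass := (mass mu D).

(** The shells shrink from [rho = r / 2] with [t = 1 / 2], so that the outermost one ends at [r];
    the series converges because [a + b > 0]. The last factor of the constant comes from
    [rho ^ (a + b)]. *)
Lemma near_potential_le (a b : R) : a < 0 -> 0 < a + b ->
  exists2 C, 0 < C & forall (A r : R) g y, 0 <= A -> 0 < r ->
    measurable_fun [set: T] g -> (forall x, 0 <= g x) ->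
    (forall u, 0 < u -> u <= r -> (mass g y u <= (A * u `^ b)%:E)%E) ->
  (\int[mu]_x (D x y `^ a * (g x * \1_(B y r) x))%:E <= (C * A * r `^ (a + b))%:E)%E.
Proof.
move=> a0 ab0.
have t0 : 0 < 2^-1 :> R by rewrite invr_gt0.
have t1 : 2^-1 < 1 :> R by rewrite invf_lt1// ltr1n.
have tab : (2^-1 : R) `^ (a + b) < 1 by exact: powR_lt1.
exists (2 `^ b / (1 - 2^-1 `^ (a + b)) * 2^-1 `^ (a + b)).
  by rewrite !mulr_gt0 ?invr_gt0 ?powR_gt0 ?subr_gt0.
move=> A r g y A0 r0 mg g0 massg.
apply: (@le_trans _ _ _ _ _ (shell_potential_le qm (rho := r * 2^-1) (t := 2^-1)
  (X := B y r) (b := b) a0 A0 _ t0 tab mg g0 _ _)).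
- by rewrite mulr_gt0.
- move=> x xy Dxy0; have := @dyadic_shell_gt1 _ (r / D x y).
  rewrite ltr_pdivlMr// mul1r => /(_ xy)[k /andP[kx xk]]; exists k.
  have p2 : 0 < 2 ^+ k :> R by rewrite exprn_gt0.
  rewrite exprVn; apply/andP; split.
    move: xk; rewrite ler_pdivrMr// => xk.
    rewrite !ler_pdivrMr//; apply: le_trans xk _; rewrite le_eqVlt.
    by apply/orP; left; apply/eqP; ring.
  move: kx; rewrite ltr_pdivlMr// => kx.
  rewrite mulrA (mulrC r) mulrA divff// mul1r ltr_pdivlMr//.
  by rewrite mulrC.
- move=> k; apply: massg; first by rewrite !mulr_gt0// exprn_gt0.
  rewrite mulrA (mulrC r) mulrA divff// mul1r.
  by rewrite ler_piMr ?(ltW r0)// exprn_ile1// ltW.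
rewrite lee_fin (powRM _ (ltW r0) (ltW t0)) le_eqVlt; apply/orP; left; apply/eqP; ring.
Qed.

(** The shells grow from [rho = r] with [t = 2], and the series converges because [a + b < 0]. *)
Lemma far_potential_le (a b : R) : a < 0 -> a + b < 0 ->
  exists2 C, 0 < C & forall (A r : R) g y, 0 <= A -> 0 < r ->
    measurable_fun [set: T] g -> (forall x, 0 <= g x) ->
    (forall u, r <= u -> (mass g y u <= (A * u `^ b)%:E)%E) ->
  (\int[mu]_x (D x y `^ a * (g x * \1_(~` B y r) x))%:E <= (C * A * r `^ (a + b))%:E)%E.
Proof.
move=> a0 ab0.
have tab : (2 : R) `^ (a + b) < 1 by rewrite powR_gt1_lt1// ltr1n.
exists (2 `^ b / (1 - 2 `^ (a + b))).
  by rewrite !mulr_gt0 ?invr_gt0 ?powR_gt0 ?subr_gt0.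
move=> A r g y A0 r0 mg g0 massg.
apply: (@le_trans _ _ _ _ _ (shell_potential_le qm (rho := r) (t := 2)
  (X := ~` B y r) (b := b) a0 A0 r0 _ tab mg g0 _ _)) => //.
- move=> x xy Dxy0; have := @dyadic_shell_ge1 _ (D x y / r).
  rewrite ler_pdivlMr// mul1r leNgt => /(_ (introN idP xy))[k /andP[kx xk]]; exists k.
  move: kx xk; rewrite ler_pdivlMr// ltr_pdivrMr// => kx xk.
  by rewrite (mulrC r) kx/= mulrA.
- move=> k; apply: massg; rewrite mulrCA ler_peMr ?(ltW r0)//.
  by rewrite -exprS exprn_ege1// ler1n.
by rewrite lee_fin le_eqVlt; apply/orP; left; apply/eqP; ring.
Qed.

End near_far.

(** * A Hedberg-type bound for the Riesz potential *)

Section riesz.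
Context {disp} {T : measurableType disp} {R : realType}.
Variables (mu : {sigma_finite_measure set T -> \bar R}) (D : T -> T -> R) (e c : R).
Hypothesis qm : regular_quasi_metric mu D e c.
Variables (gamma beta q : R).
Hypotheses (gamma_gt0 : 0 < gamma) (gamma_lt : gamma < e) (beta_lt : beta < - gamma)
  (q_gt1 : 1 < q).
Implicit Types (g : T -> R) (x y z : T) (r : R).

Local Notation B := (qball D).
Local Notation mass := (mass mu D).

(** The number for which [beta * (1 - th) = gamma + beta]: if [rho ^ beta = S], then
    [S * rho ^ gamma] and [rho ^ (gamma + beta)] both equal [S ^ (1 - th)]. The exponents of the
    weight are [s = q / th] and [l = p / th]. *)
Definition olsen_theta : R := - (gamma / beta).
Definition olsen_exp : R := q / (1 - olsen_theta).

Local Notation th := olsen_theta.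
Local Notation v := olsen_exp.

Lemma olsen_beta_lt0 : beta < 0.
Proof. by apply: lt_trans beta_lt _; rewrite oppr_lt0. Qed.

Lemma olsen_theta_gt0 : 0 < th.
Proof. by rewrite oppr_gt0 pmulr_rlt0// invr_lt0 olsen_beta_lt0. Qed.

Lemma olsen_theta_lt1 : th < 1.
Proof.
rewrite /olsen_theta -mulrN -invrN ltr_pdivrMr ?oppr_gt0 ?olsen_beta_lt0// mul1r.
by rewrite ltrNr.
Qed.

Lemma beta_olsen_theta : beta * (1 - th) = gamma + beta.
Proof.
rewrite /olsen_theta opprK mulrDr mulr1 mulrCA divff ?lt_eqF ?olsen_beta_lt0//.
by rewrite mulr1 addrC.
Qed.

Lemma olsen_theta_exp : (1 - th) * v = q.
Proof. by rewrite mulrC mulfVK// gt_eqF// subr_gt0 olsen_theta_lt1. Qed.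

Lemma olsen_exp_gt1 : 1 < v.
Proof.
have := olsen_theta_gt0; have := olsen_theta_lt1 => th1 th0.
rewrite /olsen_exp ltr_pdivlMr ?subr_gt0// mul1r; apply: lt_trans q_gt1.
by rewrite ltrBlDr ltrDl.
Qed.

Let expB1_ge0 : 0 <= v - 1. Proof. by rewrite subr_ge0 ltW ?olsen_exp_gt1. Qed.

Lemma riesz_exp_lt0 : gamma - e < 0. Proof. by rewrite subr_lt0. Qed.

Definition potential g x : \bar R := (\int[mu]_z (D z x `^ (gamma - e) * g z)%:E)%E.

(** The two terms of the minimum agree exactly when [g z = D z x ^ beta]. The power [v - 1] of the
    minimum supplies the factor [lam ^ (v - 1)] that turns a bound for [lam] into one for
    [lam ^ v]. *)
Definition potential_majorant g x : \bar R :=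
  (\int[mu]_z (D z x `^ (gamma - e) *
     (g z * Num.min (D z x `^ (gamma + beta)) (g z `^ (1 - th)) `^ (v - 1)))%:E)%E.

Lemma measurable_majorant g : measurable_fun [set: T] g ->
  measurable_fun [set: T * T] (fun u => D u.2 u.1 `^ (gamma - e) *
     (g u.2 * Num.min (D u.2 u.1 `^ (gamma + beta)) (g u.2 `^ (1 - th)) `^ (v - 1))).
Proof.
move=> mg.
have mg2 : measurable_fun [set: T * T] (fun u => g u.2) by exact: measurableT_comp.
have mD a : measurable_fun [set: T * T] (fun u => D u.2 u.1 `^ a).
  by apply: (measurableT_comp (measurable_powR a)); apply: (measurable_dist qm).
apply: measurable_funM => //; apply: measurable_funM => //.
apply: (measurableT_comp (measurable_powR _)); apply: measurable_minr => //.
exact: (measurableT_comp (measurable_powR _)).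
Qed.

Lemma majorant_ge0 g x z : (forall z, 0 <= g z) ->
  0 <= D z x `^ (gamma - e) *
     (g z * Num.min (D z x `^ (gamma + beta)) (g z `^ (1 - th)) `^ (v - 1)).
Proof. by move=> g0; rewrite !mulr_ge0// powR_ge0. Qed.

(* Hedberg's splitting at the radius where the far part equals a fixed fraction of
   the value.  On the near part one may also assume g > r ^ beta, and there both
   terms of the minimum exceed the value up to a constant. *)
Lemma potential_pow_le A : 0 < A -> exists2 C, 0 < C & forall g,
  measurable_fun [set: T] g -> (forall x, 0 <= g x) ->
  (forall x r, 0 < r -> (mass g x r <= (A * r `^ (e + beta))%:E)%E) ->
  forall x lam, 0 <= lam -> (lam%:E <= potential g x)%E ->
    ((lam `^ v)%:E <= C%:E * potential_majorant g x)%E.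
Proof.
move=> A0.
have e0 := qm_dim_gt0 qm; have c0 := qm_cst_gt0 qm.
have gb0 : gamma + beta < 0 by rewrite -ltrBrDl sub0r.
have [C2 C20 nearP] := @near_potential_le _ _ _ _ _ _ _ qm (gamma - e) e riesz_exp_lt0
  ltac:(by rewrite subrK).
have [C1 C10 farP] := @far_potential_le _ _ _ _ _ _ _ qm (gamma - e) (e + beta) riesz_exp_lt0
  ltac:(by rewrite addrA subrK).
pose C := Num.max (C1 * A) (C2 * c).
have C0 : 0 < C by rewrite lt_max mulr_gt0.
(* With [rho ^ (gamma + beta) = lam / c1] below, the factor 4 makes the far part and the part with
   small values at most [lam / 4] each. *)
pose c1 := 4 * C.
have c10 : 0 < c1 by rewrite mulr_gt0.
exists (2 * c1 `^ (v - 1)); first by rewrite mulr_gt0 ?powR_gt0.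
move=> g mg g0 morrey x lam lam0 lamJ.
have v0 : v != 0 by rewrite gt_eqF// (lt_trans ltr01 olsen_exp_gt1).
have Q0 : (0 <= potential_majorant g x)%E.
  by apply: integral_ge0 => z _; rewrite lee_fin majorant_ge0.
move: lam0; rewrite le_eqVlt => /predU1P[<-|lam0].
  by rewrite powR0// mule_ge0// lee_fin mulr_ge0// powR_ge0.
pose rho := (lam / c1) `^ (gamma + beta)^-1.
have lc0 : 0 < lam / c1 by rewrite divr_gt0.
have rho0 : 0 < rho by rewrite powR_gt0.
have rhoE : rho `^ (gamma + beta) = lam / c1 by rewrite powRrV ?ltW// lt_eqF.
pose h := rho `^ beta.
have h0 : 0 < h by rewrite powR_gt0.
(* Where the minimum [m z] is at least [lam / c1], the weight [k * m z ^ (v - 1)] is at least 1. *)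
pose k := (lam / c1) `^ (1 - v).
have k0 : 0 < k by rewrite powR_gt0.
pose m z := Num.min (D z x `^ (gamma + beta)) (g z `^ (1 - th)).
pose f1 z := D z x `^ (gamma - e) * (g z * \1_(~` B x rho) z).
pose f2 z := D z x `^ (gamma - e) * (h * \1_(B x rho) z).
pose f3 z := D z x `^ (gamma - e) * (g z * m z `^ (v - 1)).
have f1_ge0 z : 0 <= f1 z by rewrite !mulr_ge0// powR_ge0.
have f2_ge0 z : 0 <= f2 z by rewrite !mulr_ge0 ?powR_ge0.
have f3_ge0 z : 0 <= f3 z by exact: majorant_ge0.
have mD := measurable_dist_pow qm x.
have mB := measurable_qball qm x rho.
have mf1 : measurable_fun [set: T] f1.
  apply: measurable_funM => //; apply: measurable_funM => //.
  by apply: measurable_indic; exact: measurableC.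
have mf2 : measurable_fun [set: T] f2.
  by apply: measurable_funM => //; apply: measurable_funM => //; exact: measurable_indic.
have mf3 : measurable_fun [set: T] f3.
  exact: (measurableT_comp (measurable_majorant mg) (measurable_pair1 x)).
(* At every point one of three terms suffices: [f1] off the ball, [f2] on the ball where [g <= h],
   and [k * f3] on the ball where [g > h]. *)
have splitJ : (potential g x <= \int[mu]_z (f1 z)%:E + \int[mu]_z (f2 z)%:E
    + k%:E * potential_majorant g x)%E.
  have k_ge0 := ltW k0.
  have -> : (k%:E * potential_majorant g x = \int[mu]_z (k * f3 z)%:E)%E.
    rewrite /potential_majorant -ge0_integralZl_EFin//.
      by move=> z _; rewrite lee_fin f3_ge0.
    exact/measurable_EFinP.
  rewrite -ge0_integralD//; try by [move=> z _; rewrite lee_fin|exact/measurable_EFinP].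
  rewrite -ge0_integralD//; last 4 first.
    by move=> z _; rewrite adde_ge0 ?lee_fin.
    by apply: emeasurable_funD; exact/measurable_EFinP.
    by move=> z _; rewrite lee_fin mulr_ge0.
    by apply/measurable_EFinP; exact: measurable_funM.
  apply: le_lower_integral => z _; first by rewrite lee_fin mulr_ge0 ?powR_ge0.
  rewrite -!EFinD lee_fin.
  have kf3 : 0 <= k * f3 z by rewrite mulr_ge0.
  have [zB|zB] := pselect (B x rho z); last first.
    apply: (@le_trans _ _ (f1 z)); last by rewrite -addrA lerDl addr_ge0.
    by rewrite /f1 indicE mem_set// mulr1.
  have [gh|gh] := leP (g z) h.
    apply: (@le_trans _ _ (f2 z)); last by rewrite addrAC lerDr addr_ge0.
    by rewrite /f2 indicE mem_set// mulr1 ler_wpM2l ?powR_ge0.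
  apply: (@le_trans _ _ (k * f3 z)); last by rewrite lerDr addr_ge0.
  have := qm_ge0 qm z x; rewrite le_eqVlt => /predU1P[Dzx|Dzx].
    by rewrite -Dzx powR0 ?lt_eqF ?riesz_exp_lt0// mul0r.
  rewrite /f3 mulrCA ler_wpM2l ?powR_ge0// mulrCA ler_peMr//.
  rewrite /k -(opprB v) powRN ler_pdivlMl ?powR_gt0// mulr1.
  (* Both terms of the minimum are at least [rho ^ (gamma + beta) = lam / c1]: the first because
     [D z x < rho] and the exponent is negative, the second because [g z > rho ^ beta]. *)
  apply: gt0_ler_powR => //; rewrite le_min -rhoE; apply/andP; split.
    by apply: lt0_ger_powR => //; [exact: (ltW zB)|exact: ltW].
  rewrite -beta_olsen_theta powRrM; apply: gt0_ler_powR => //; first exact: ltW.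
  by rewrite subr_ge0 ltW ?olsen_theta_lt1.
have If1 : (\int[mu]_z (f1 z)%:E <= (lam / 4)%:E)%E.
  apply: (@le_trans _ _ (C1 * A * rho `^ (gamma - e + (e + beta)))%:E).
    apply: farP => //; first exact: ltW.
    by move=> u ru; apply: morrey; exact: lt_le_trans ru.
  rewrite lee_fin addrA subrK rhoE.
  rewrite [leRHS](_ : _ = C * (lam / c1)); last by rewrite /c1; field; rewrite gt_eqF.
  by rewrite ler_wpM2r ?(ltW lc0)// le_max lexx.
have If2 : (\int[mu]_z (f2 z)%:E <= (lam / 4)%:E)%E.
  apply: (@le_trans _ _ (C2 * (h * c) * rho `^ (gamma - e + e))%:E).
    apply: (nearP (h * c) rho (cst h) x) => //.
    - by rewrite mulr_ge0 ?ltW.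
    - by move=> z; exact: ltW.
    move=> u u0 _; rewrite (mass_cst qm) ?(ltW h0)// -mulrA EFinM.
    by rewrite lee_wpmul2l ?lee_fin ?(ltW h0)//; exact: (qm_ball_le qm).
  rewrite lee_fin subrK.
  rewrite [leRHS](_ : _ = C * (lam / c1)); last by rewrite /c1; field; rewrite gt_eqF.
  rewrite [leLHS](_ : _ = C2 * c * (lam / c1)).
    by rewrite ler_wpM2r ?(ltW lc0)// le_max lexx orbT.
  by rewrite -rhoE powRD_gt0// -/h; ring.
have lamQ : ((lam / 2)%:E <= k%:E * potential_majorant g x)%E.
  have : (lam%:E <= (lam / 2)%:E + k%:E * potential_majorant g x)%E.
    apply: (le_trans lamJ); apply: (le_trans splitJ); apply: leeD2r.
    apply: (le_trans (leeD If1 If2)); rewrite -EFinD lee_fin; lra.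
  rewrite -leeBlDl// => /(le_trans _); apply; rewrite -EFinB lee_fin; lra.
(* This factor turns [lam / 2] into [lam ^ v]; on the right it cancels the dependence of [k] on
   [lam], as [lam ^ (v - 1) * k = c1 ^ (v - 1)]. *)
have l2 : 0 < 2 * lam `^ (v - 1) by rewrite mulr_gt0 ?powR_gt0.
have : ((2 * lam `^ (v - 1))%:E * (lam / 2)%:E <=
  (2 * lam `^ (v - 1))%:E * (k%:E * potential_majorant g x))%E.
  by rewrite lee_pmul2l ?lte_fin.
rewrite muleA -!EFinM.
have -> : 2 * lam `^ (v - 1) * (lam / 2) = lam `^ v.
  by rewrite -(mulr_powRB1 (ltW lam0) (lt_trans ltr01 olsen_exp_gt1)); field.
have -> // : 2 * lam `^ (v - 1) * k = 2 * c1 `^ (v - 1).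
have -> : lam `^ (v - 1) = c1 `^ (v - 1) * (lam / c1) `^ (v - 1).
  by rewrite -powRM ?(ltW c10) ?(ltW lc0)// mulrCA divff ?mulr1// gt_eqF.
by rewrite /k -(opprB v) powRN -!mulrA divff ?mulr1// gt_eqF// powR_gt0.
Qed.

(* Tonelli; for fixed z the inner integral is split at the radius g z ^ (1 / beta),
   where the two terms of the minimum are equal. *)
Lemma integral_majorant_le : exists2 C, 0 < C & forall g,
  measurable_fun [set: T] g -> (forall x, 0 <= g x) ->
  (\int[mu]_x potential_majorant g x <= C%:E * \int[mu]_z (g z `^ q)%:E)%E.
Proof.
have e0 := qm_dim_gt0 qm; have c0 := qm_cst_gt0 qm.
have gb0 : gamma + beta < 0 by rewrite -ltrBrDl sub0r.
have v0 : 0 < v := lt_trans ltr01 olsen_exp_gt1.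
(* The exponent of the distance where the minimum is its power of the distance. The identity
   [a + e = beta * (q - 1)] makes [a + e] negative, so the outer integral converges. *)
pose a := gamma - e + (gamma + beta) * (v - 1).
have aE : a + e = beta * (q - 1).
  rewrite -olsen_theta_exp mulrBr mulrA beta_olsen_theta /a; ring.
have [C2 C20 nearP] := @near_potential_le _ _ _ _ _ _ _ qm (gamma - e) e riesz_exp_lt0
  ltac:(by rewrite subrK).
have [C1 C10 farP] := @far_potential_le _ _ _ _ _ _ _ qm a e
  ltac:(by rewrite -(ltrD2r e) add0r aE (lt_trans _ e0)// nmulr_rlt0 ?olsen_beta_lt0// subr_gt0)
  ltac:(by rewrite aE nmulr_rlt0 ?olsen_beta_lt0// subr_gt0).
exists (C2 * c + C1 * c); first by rewrite addr_gt0 ?mulr_gt0.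
move=> g mg g0.
have mg2 : measurable_fun [set: T] (fun z => (g z `^ q)%:E).
  by apply/measurable_EFinP; exact: (measurableT_comp (measurable_powR _)).
rewrite /potential_majorant.
pose F (u : T * T) := (D u.2 u.1 `^ (gamma - e) *
     (g u.2 * Num.min (D u.2 u.1 `^ (gamma + beta)) (g u.2 `^ (1 - th)) `^ (v - 1)))%:E.
rewrite (@fubini_tonelli _ _ _ _ _ mu mu F); last 2 first.
  by apply/measurable_EFinP; exact: measurable_majorant.
  by move=> u; rewrite lee_fin; exact: majorant_ge0.
rewrite -ge0_integralZl_EFin//; last 2 first.
  by move=> z _; rewrite lee_fin powR_ge0.
  by rewrite addr_ge0 ?mulr_ge0 ?ltW.
apply: le_lower_integral => z _.
  by apply: integral_ge0 => x _; rewrite lee_fin; exact: majorant_ge0.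
rewrite /F/=; have := g0 z; rewrite le_eqVlt => /predU1P[<-|].
  rewrite integral0_eq ?mule_ge0// ?lee_fin ?addr_ge0 ?mulr_ge0 ?powR_ge0 ?ltW//.
  by move=> x _; rewrite mul0r mulr0.
set t := g z => t0; pose rho := t `^ beta^-1.
have rho0 : 0 < rho by rewrite powR_gt0.
have rhoE : rho `^ beta = t by rewrite powRrV ?ltW ?lt_eqF ?olsen_beta_lt0.
pose h := t * (t `^ (1 - th)) `^ (v - 1).
have h0 : 0 < h by rewrite mulr_gt0 ?powR_gt0.
have hE : h = t * (t `^ (1 - th)) `^ (v - 1) by [].
clearbody h.
have mD b : measurable_fun [set: T] (fun x => D x z `^ b) := measurable_dist_pow qm z b.
have mB := measurable_qball qm z rho.
pose f1 x := D x z `^ (gamma - e) * (h * \1_(B z rho) x).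
pose f2 x := t * (D x z `^ a * (1 * \1_(~` B z rho) x)).
have h_ge0 := ltW h0; have t_ge0 := ltW t0.
have f1_ge0 x : 0 <= f1 x by rewrite !mulr_ge0// powR_ge0.
have f2_ge0 x : 0 <= f2 x by rewrite !mulr_ge0// powR_ge0.
have mf1 : measurable_fun [set: T] f1.
  by apply: measurable_funM => //; apply: measurable_funM => //; exact: measurable_indic.
have mf2' : measurable_fun [set: T] (fun x => D x z `^ a * (1 * \1_(~` B z rho) x)).
  apply: measurable_funM => //; apply: measurable_funM => //.
  by apply: measurable_indic; exact: measurableC.
have mf2 : measurable_fun [set: T] f2 by exact: measurable_funM.
apply: (@le_trans _ _ (\int[mu]_x (f1 x)%:E + \int[mu]_x (f2 x)%:E)%E).
  rewrite -ge0_integralD//; try by [move=> x _; rewrite lee_fin|exact/measurable_EFinP].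
  apply: le_lower_integral => x _; rewrite -?EFinD lee_fin; first exact: majorant_ge0.
  rewrite (qm_sym qm z x).
  have min0 : 0 <= Num.min (D x z `^ (gamma + beta)) (t `^ (1 - th)).
    by rewrite le_min !powR_ge0.
  have [xB|xB] := pselect (B z rho x).
    rewrite [f2 x](_ : _ = 0) ?addr0; last by rewrite /f2 indicE memNset ?mulr0//; exact.
    rewrite /f1 indicE mem_set// mulr1 ler_wpM2l ?powR_ge0// hE ler_wpM2l//.
    by apply: ge0_ler_powR; rewrite ?nnegrE ?powR_ge0// ge_min lexx orbT.
  rewrite [f1 x](_ : _ = 0) ?add0r; last by rewrite /f1 indicE memNset ?mulr0.
  have Dxz : 0 < D x z.
    by apply: lt_le_trans rho0 _; rewrite leNgt; apply/negP.
  rewrite /f2 indicE mem_set// !mulr1 mulrCA ler_wpM2l//.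
  rewrite /a [leRHS]powRD_gt0// ler_wpM2l ?powR_ge0// powRrM.
  by apply: ge0_ler_powR; rewrite ?nnegrE ?powR_ge0// ge_min lexx.
rewrite -EFinM mulrDl EFinD; apply: leeD.
  apply: (@le_trans _ _ (C2 * (h * c) * rho `^ (gamma - e + e))%:E).
    apply: (nearP (h * c) rho (cst h) z) => //.
    - by rewrite mulr_ge0 ?ltW.
    move=> u u0 _; rewrite (mass_cst qm) ?(ltW h0)// -mulrA EFinM.
    by rewrite lee_wpmul2l ?lee_fin ?(ltW h0)//; exact: (qm_ball_le qm).
  (* Here [h = t ^ (q + th)] and [rho ^ gamma = t ^ (- th)]. *)
  rewrite lee_fin subrK [leLHS](_ : _ = C2 * c * t `^ q)//.
  rewrite hE /rho -!powRrM -[X in X * _ `^ _](powRr1 (ltW t0)).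
  rewrite (mulrC _ c) !mulrA -[in LHS]mulrA -powRD_gt0// -mulrA -powRD_gt0//.
  congr (_ * _ `^ _); rewrite mulrBr mulr1 olsen_theta_exp /olsen_theta; field.
  by rewrite lt_eqF ?olsen_beta_lt0.
rewrite /f2; under eq_integral do rewrite EFinM.
rewrite ge0_integralZl_EFin ?(ltW t0)//; last 2 first.
  by move=> x _; rewrite lee_fin !mulr_ge0 ?powR_ge0.
  exact/measurable_EFinP.
apply: (@le_trans _ _ (t%:E * (C1 * c * rho `^ (a + e))%:E)%E).
  rewrite lee_pmul2l ?lte_fin//; apply: (farP c rho (cst 1) z) => //; first exact: ltW.
  move=> u u0; rewrite (mass_cst qm)// mul1e; apply: (qm_ball_le qm).
  exact: lt_le_trans u0.
(* Here [rho ^ (a + e) = t ^ (q - 1)]. *)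
rewrite -EFinM lee_fin aE powRrM rhoE mulrCA mulr_powRB1 ?(ltW t0)//.
exact: lt_trans q_gt1.
Qed.

End riesz.

(** * The tail of the potential, seen from a ball *)

Section local_estimate.
Context {disp} {T : measurableType disp} {R : realType}.
Variables (mu : {sigma_finite_measure set T -> \bar R}) (D : T -> T -> R) (e c : R).
Hypothesis qm : regular_quasi_metric mu D e c.
Variables (gamma beta q : R).
Hypotheses (gamma_gt0 : 0 < gamma) (gamma_lt : gamma < e) (beta_lt : beta < - gamma)
  (q_gt1 : 1 < q).
Implicit Types (g : T -> R) (x y z : T) (r : R).

Local Notation B := (qball D).
Local Notation mass := (mass mu D).
Local Notation th := (olsen_theta gamma beta).
Local Notation v := (olsen_exp gamma beta q).
Local Notation potential := (potential mu D e gamma).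

Lemma le_mass (g1 g2 : T -> R) y r : (forall x, 0 <= g1 x) ->
  (forall x, B y r x -> g1 x <= g2 x) -> (mass g1 y r <= mass g2 y r)%E.
Proof.
move=> g10 g12; apply: le_lower_integral => x _; rewrite lee_fin.
  by rewrite mulr_ge0.
have [xB|xB] := pselect (B y r x); first by rewrite ler_wpM2r// g12.
by rewrite indicE memNset// !mulr0.
Qed.

(** The constant 2 of the weak triangle inequality is what doubles the radius. *)
Lemma mass_slide g x y r : (forall z, 0 <= g z) -> D y x < r ->
  (mass g x r <= mass g y (2 * r))%E.
Proof.
move=> g0 yx; apply: le_lower_integral => z _; rewrite lee_fin; first by rewrite mulr_ge0.
rewrite ler_wpM2l// !(qball_indE D).
have [zx|] := boolP (D z x < r); last by rewrite ler0n.
rewrite (_ : D z y < _)//; apply: le_lt_trans (qm_triangle qm z x y) _.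
by rewrite ltr_pM2l// gt_max zx (qm_sym qm).
Qed.

(* For S > 0, g <= S + S^(1-q) g^q pointwise. *)
Lemma mass_pow_le g y r (S a : R) : measurable_fun [set: T] g -> (forall x, 0 <= g x) ->
  0 < r -> 0 < S -> (mass (fun x => g x `^ q)%R y r <= (a * (S `^ q * r `^ e))%:E)%E ->
  (mass g y r <= ((a + c) * S * r `^ e)%:E)%E.
Proof.
move=> mg g0 r0 S0 massq.
have mgq : measurable_fun [set: T] (fun x => S `^ (1 - q) * g x `^ q).
  by apply: measurable_funM => //; exact: (measurableT_comp (measurable_powR _)).
have S_ge0 := ltW S0.
apply: (@le_trans _ _ ((S `^ (1 - q))%:E * mass (fun x => g x `^ q)%R y r
   + mass (cst S) y r)%E).
  rewrite /mass -ge0_integralZl_EFin ?powR_ge0//; last 2 first.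
    by move=> x _; rewrite lee_fin mulr_ge0 ?powR_ge0.
    apply: (measurable_integrand qm) => //.
    exact: (measurableT_comp (measurable_powR _)).
  under [X in (_ <= X + _)%E]eq_integral do rewrite -EFinM mulrA.
  rewrite -ge0_integralD//; last 4 first.
  - by move=> x _; rewrite lee_fin !mulr_ge0 ?powR_ge0.
  - exact: (measurable_integrand qm).
  - by move=> x _; rewrite lee_fin mulr_ge0.
  - exact: (measurable_integrand qm).
  apply: le_lower_integral => x _; rewrite -?EFinD lee_fin; first by rewrite mulr_ge0.
  rewrite -mulrDl ler_wpM2r//=.
  have [gS|Sg] := leP (g x) S.
    by apply: le_trans gS _; rewrite lerDr mulr_ge0 ?powR_ge0.
  apply: (@le_trans _ _ (S `^ (1 - q) * g x `^ q)); last by rewrite lerDl.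
  have gx0 := lt_trans S0 Sg.
  rewrite -{1}(powRr1 (ltW gx0)) -{1}(subrK q 1) powRD_gt0// ler_wpM2r ?powR_ge0//.
  by apply: lt0_ger_powR => //; [exact: ltW | rewrite subr_le0 ltW].
rewrite (mass_cst qm)// 2!mulrDl EFinD; apply: leeD.
  apply: (@le_trans _ _ ((S `^ (1 - q))%:E * (a * (S `^ q * r `^ e))%:E)%E).
    by rewrite lee_pmul2l ?lte_fin ?powR_gt0.
  rewrite -EFinM lee_fin [leLHS](_ : _ = a * (S `^ (1 - q) * S `^ q) * r `^ e); last by ring.
  by rewrite -powRD_gt0// subrK powRr1.
apply: (@le_trans _ _ (S%:E * (c * r `^ e)%:E)%E).
  by rewrite lee_pmul2l ?lte_fin//; exact: (qm_ball_le qm).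
by rewrite -EFinM lee_fin mulrCA mulrA.
Qed.

Lemma mul_ind_id (h : T -> R) (X : set T) x : 0 <= h x -> h x * \1_X x <= h x.
Proof. by move=> h0; rewrite ler_piMr// indicE; case: (_ \in _). Qed.

Variable A : R.
Hypothesis A_gt0 : 0 < A.

Definition morrey g :=
  forall x r, 0 < r -> (mass g x r <= (A * r `^ (e + beta))%:E)%E.

Lemma morrey_ind g (X : set T) : (forall x, 0 <= g x) -> morrey g ->
  morrey (fun x => g x * \1_X x).
Proof.
move=> g0 Mg x r r0; apply: le_trans (Mg x r r0); apply: le_mass => z.
  by rewrite mulr_ge0.
by move=> _; exact: mul_ind_id.
Qed.

(** Hedberg's argument at the single centre [y], where [S] bounds the averages that a maximal
    function would control. The split is at [rho = S ^ (1 / beta)]: the inner part is of order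
    [S * rho ^ gamma], the outer part, by the Morrey bound, of order [rho ^ (gamma + beta)], and
    both are [S ^ (1 - th)]. *)
Lemma tail_potential_le : exists2 C, 0 < C & forall g,
  measurable_fun [set: T] g -> (forall x, 0 <= g x) -> morrey g ->
  forall y r (S : R), 0 < r -> 0 < S ->
  (forall u, r <= u -> (mass (fun x => g x `^ q)%R y u <= (S `^ q * u `^ e)%:E)%E) ->
  (potential (fun z => g z * \1_(~` B y r) z)%R y <= (C * S `^ (1 - th))%:E)%E.
Proof.
have e0 := qm_dim_gt0 qm; have c0 := qm_cst_gt0 qm.
have gb0 : gamma + beta < 0 by rewrite -ltrBrDl sub0r.
have b0 := olsen_beta_lt0 gamma_gt0 beta_lt.
have ge0 := riesz_exp_lt0 gamma_lt.
have [C2 C20 nearP] := @near_potential_le _ _ _ _ _ _ _ qm (gamma - e) e ge0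
  ltac:(by rewrite subrK).
have [C1 C10 farP] := @far_potential_le _ _ _ _ _ _ _ qm (gamma - e) (e + beta) ge0
  ltac:(by rewrite addrA subrK).
exists (C2 * (1 + c) + C1 * A); first by rewrite addr_gt0 ?mulr_gt0// addr_gt0.
move=> g mg g0 Mg y r S r0 S0 massq.
pose rho := S `^ beta^-1.
have rho0 : 0 < rho by rewrite powR_gt0.
pose g' z := g z * \1_(~` B y r) z.
have g'0 z : 0 <= g' z by rewrite mulr_ge0.
have mg' : measurable_fun [set: T] g'.
  by apply: measurable_funM => //; apply/measurable_indic/measurableC/(measurable_qball qm).
have Mg' : morrey g' by exact: morrey_ind.
have mB := measurable_qball qm y rho.
have mD := measurable_dist_pow qm y.
have split1 z : D z y `^ (gamma - e) * g' z =
    D z y `^ (gamma - e) * (g' z * \1_(B y rho) z) +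
    D z y `^ (gamma - e) * (g' z * \1_(~` B y rho) z).
  have ind1 : \1_(B y rho) z + \1_(~` B y rho) z = 1 :> R.
    have [zB|zB] := pselect (B y rho z).
      by rewrite !indicE mem_set// memNset ?addr0//; exact.
    by rewrite !indicE memNset// mem_set// add0r.
  by rewrite -mulrDr -mulrDr ind1 mulr1.
rewrite /potential -/g'; under eq_integral do rewrite split1 EFinD.
rewrite ge0_integralD//; last 4 first.
- by move=> z _; rewrite lee_fin !mulr_ge0 ?powR_ge0.
- exact: (measurable_kernel_ind qm).
- by move=> z _; rewrite lee_fin !mulr_ge0 ?powR_ge0.
- by apply: (measurable_kernel_ind qm) => //; exact: measurableC.
rewrite mulrDl EFinD; apply: leeD.
  apply: (@le_trans _ _ (C2 * ((1 + c) * S) * rho `^ (gamma - e + e))%:E).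
    apply: nearP => //; first by rewrite mulr_ge0 ?addr_ge0 ?ltW.
    (* Averages are controlled only for radii at least [r]; over smaller balls the truncated
       function has mass zero. *)
    move=> u u0 _; have [ur|ru] := leP u r.
      rewrite /mass integral0_eq => [|z _].
        by rewrite lee_fin !mulr_ge0 ?powR_ge0 ?addr_ge0 ?ltW.
      have [zB|zB] := pselect (B y u z); last by rewrite indicE memNset// mulr0.
      have zr : B y r z by exact: lt_le_trans zB ur.
      by rewrite /g' [X in _ * X * _]indicE memNset ?mulr0 ?mul0r//; exact.
    apply: (@le_trans _ _ (mass g y u)).
      by apply: le_mass => // z _; exact: mul_ind_id.
    apply: mass_pow_le => //; rewrite mul1r; apply: massq; exact: ltW.
  rewrite lee_fin subrK le_eqVlt; apply/orP; left; apply/eqP.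
  rewrite mulrA -mulrA; congr (_ * _).
  rewrite /rho -powRrM -{1}(powRr1 (ltW S0)) -powRD_gt0//; congr (_ `^ _).
  by rewrite /olsen_theta opprK mulrC.
apply: (@le_trans _ _ (C1 * A * rho `^ (gamma - e + (e + beta)))%:E).
  apply: farP => //; first exact: ltW.
  by move=> u u0; apply: Mg'; exact: lt_le_trans u0.
rewrite lee_fin addrA subrK -(beta_olsen_theta gamma_gt0 beta_lt) /rho -powRrM.
by rewrite mulrA mulVf ?mul1r// lt_eqF.
Qed.

(** For [z] off [B y (4 * r)] the larger of [D z x] and [D x y] is [D z x], since
    [2 * D x y < 4 * r <= D z y]. Hence [D z y <= 2 * D z x], and the kernel at [x] is at most
    [2 ^ (e - gamma)] times the kernel at [y]: the tail is bounded by one number on the whole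
    ball. *)
Lemma potential_split g y x r : measurable_fun [set: T] g -> (forall x, 0 <= g x) ->
  0 < r -> B y r x ->
  (potential g x <= potential (fun z => g z * \1_(B y (4 * r)) z)%R x
     + (2 `^ (e - gamma))%:E * potential (fun z => g z * \1_(~` B y (4 * r)) z)%R y)%E.
Proof.
move=> mg g0 r0 xB.
have mB := measurable_qball qm y (4 * r).
have mD := measurable_dist_pow qm.
have ge0 := riesz_exp_lt0 gamma_lt.
rewrite /potential -ge0_integralZl_EFin ?powR_ge0//; last 2 first.
  by move=> z _; rewrite lee_fin !mulr_ge0 ?powR_ge0.
  by apply: (measurable_kernel_ind qm) => //; exact: measurableC.
rewrite -ge0_integralD//; last 4 first.
- by move=> z _; rewrite lee_fin !mulr_ge0 ?powR_ge0.
- exact: (measurable_kernel_ind qm).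
- by move=> z _; rewrite -EFinM lee_fin !mulr_ge0 ?powR_ge0.
- by apply/measurable_funeM/(measurable_kernel_ind qm) => //; exact: measurableC.
apply: le_lower_integral => z _; first by rewrite lee_fin !mulr_ge0 ?powR_ge0.
rewrite -EFinM -EFinD lee_fin !indicE.
have [zB|zB] := pselect (B y (4 * r) z).
  by rewrite mem_set// mulr1 lerDl !mulr_ge0 ?powR_ge0.
rewrite memNset// mem_set// !mulr0 add0r mulr1 mulrA ler_wpM2r//.
have zy : 4 * r <= D z y by rewrite leNgt; apply/negP.
have zx : D z y <= 2 * D z x.
  have := qm_triangle qm z x y.
  rewrite /Num.max; case: ifPn => // _ /(le_trans zy) h.
  by have : D x y < r by []; lra.
have zx0 : 0 < D z x by have := lt_le_trans (mulr_gt0 (ltr0Sn R 3) r0) zy; lra.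
rewrite -(opprB gamma e) powRN ler_pdivlMl ?powR_gt0// -powRM ?(ltW zx0)//.
by apply: lt0_ger_powR => //; [lra|exact: ltW].
Qed.

End local_estimate.

(** * The estimate on one ball *)

Section local_strong_estimate.
Context {disp} {T : measurableType disp} {R : realType}.
Variables (mu : {sigma_finite_measure set T -> \bar R}) (D : T -> T -> R) (e c : R).
Hypothesis qm : regular_quasi_metric mu D e c.
Variables (gamma beta q : R).
Hypotheses (gamma_gt0 : 0 < gamma) (gamma_lt : gamma < e) (beta_lt : beta < - gamma)
  (q_gt1 : 1 < q).
Implicit Types (g : T -> R) (x y z : T) (r : R).

Local Notation B := (qball D).
Local Notation mass := (mass mu D).
Local Notation th := (olsen_theta gamma beta).
Local Notation v := (olsen_exp gamma beta q).
Local Notation potential := (potential mu D e gamma).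
Local Notation majorant := (potential_majorant mu D e gamma beta q).

Lemma measurable_potential_majorant g : measurable_fun [set: T] g ->
  (forall x, 0 <= g x) -> measurable_fun [set: T] (majorant g).
Proof.
move=> mg g0; pose F (u : T * T) := (D u.2 u.1 `^ (gamma - e) *
  (g u.2 * Num.min (D u.2 u.1 `^ (gamma + beta)) (g u.2 `^ (1 - th)) `^ (v - 1)))%:E.
apply: (@measurable_fun_fubini_tonelli_F _ _ _ _ _ mu F).
  by apply/measurable_EFinP; exact: (measurable_majorant qm).
by move=> u; rewrite lee_fin; exact: majorant_ge0.
Qed.

(** On [B y r] the potential is at most that of the truncation [g1] plus a constant [F]. The first
    is controlled by the majorant, whose integral over the whole space is bounded. The result is
    stated as a measurable [M] above every [lam ^ v], so that it can be integrated whatever function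
    lies below the potential. *)
Lemma local_majorant A : 0 < A -> exists2 C, 0 < C & forall g,
  measurable_fun [set: T] g -> (forall x, 0 <= g x) -> morrey mu D e beta A g ->
  forall y r t, 0 < r -> 0 < t ->
  (forall u, 4 * r <= u -> (mass (fun x => g x `^ q)%R y u <= (t * (u / r) `^ e)%:E)%E) ->
  exists M : T -> \bar R, [/\ measurable_fun [set: T] M, forall x, (0 <= M x)%E,
    (\int[mu]_x M x <= (C * t)%:E)%E &
    forall x lam, B y r x -> 0 <= lam -> (lam%:E <= potential g x)%E ->
      ((lam `^ v)%:E <= M x)%E].
Proof.
move=> A0; have e0 := qm_dim_gt0 qm; have c0 := qm_cst_gt0 qm.
have th1 : 0 < 1 - th by rewrite subr_gt0; exact: olsen_theta_lt1.
have v1 : 1 < v by exact: olsen_exp_gt1.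
have v0 : 0 < v := lt_trans ltr01 v1.
have q0 : 0 < q := lt_trans ltr01 q_gt1.
have [C1 C10 powP] := potential_pow_le qm gamma_gt0 gamma_lt beta_lt q_gt1 A0.
have [C2 C20 intP] := integral_majorant_le qm gamma_gt0 gamma_lt beta_lt q_gt1.
have [C3 C30 tailP] := tail_potential_le qm gamma_gt0 gamma_lt beta_lt q_gt1 A0.
(* The first factor moves the tail from [x] to the centre [y], the second bounds it there. *)
pose k := 2 `^ (e - gamma) * C3.
have k0 : 0 < k by rewrite mulr_gt0 ?powR_gt0.
exists (2 `^ v * (k `^ v * c + C1 * C2 * 4 `^ e)).
  by rewrite mulr_gt0 ?addr_gt0 ?mulr_gt0 ?powR_gt0.
move=> g mg g0 Mg y r t r0 t0 massq.
(* Chosen so that [S ^ q * u ^ e = t * (u / r) ^ e], the form of the hypothesis on large balls. *)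
pose S := (t / r `^ e) `^ q^-1.
have tr0 : 0 < t / r `^ e by rewrite divr_gt0 ?powR_gt0.
have S0 : 0 < S by rewrite powR_gt0.
have Sq : S `^ q = t / r `^ e by rewrite powRrV ?gt_eqF// ltW.
have r40 : 0 < 4 * r by rewrite mulr_gt0.
pose F := k * S `^ (1 - th).
have F0 : 0 < F by rewrite mulr_gt0 ?powR_gt0.
pose g1 z := g z * \1_(B y (4 * r)) z.
have g10 z : 0 <= g1 z by rewrite mulr_ge0.
have mB4 := measurable_qball qm y (4 * r).
have mg1 : measurable_fun [set: T] g1.
  by apply: measurable_funM => //; exact: measurable_indic.
have Mg1 : morrey mu D e beta A g1 by exact: morrey_ind.
have potF x : B y r x -> (potential g x <= potential g1 x + F%:E)%E.
  move=> xB; apply: (le_trans (potential_split qm gamma_lt mg g0 r0 xB)).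
  rewrite -/g1 leeD2l// /F /k -mulrA EFinM lee_pmul2l ?lte_fin ?powR_gt0//.
  apply: tailP => // u u0; rewrite Sq -mulrA; apply: le_trans (massq u u0) _.
  rewrite lee_fin powRM ?invr_ge0 ?(ltW r0) ?(le_trans (ltW r40))//.
  by rewrite -powR_inv1 ?(ltW r0)// powRAC powR_inv1 ?powR_ge0// (mulrC (u `^ e)).
have Q0 x : (0 <= majorant g1 x)%E.
  by apply: integral_ge0 => z _; rewrite lee_fin; exact: majorant_ge0.
have mQ := measurable_potential_majorant mg1 g10.
have v2 : 0 <= 2 `^ v :> R by rewrite powR_ge0.
have Fv : 0 <= F `^ v by rewrite powR_ge0.
have C1_ge0 := ltW C10; have C2_ge0 := ltW C20.
have mFB : measurable_fun [set: T] (fun x => (F `^ v * \1_(B y r) x)%:E).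
  by exact: (measurable_integrand qm (g := cst (F `^ v))).
have mC1 : measurable_fun [set: T] (fun x => C1%:E * majorant g1 x)%E.
  exact: measurable_funeM.
pose M x := ((2 `^ v)%:E * ((F `^ v * \1_(B y r) x)%:E + C1%:E * majorant g1 x))%E.
exists M; split.
- by apply: measurable_funeM; exact: emeasurable_funD.
- by move=> x; rewrite mule_ge0 ?adde_ge0 ?mule_ge0 ?lee_fin// mulr_ge0.
- rewrite /M.
  rewrite ge0_integralZl_EFin//; last 2 first.
    by move=> x _; rewrite adde_ge0 ?mule_ge0 ?lee_fin// mulr_ge0.
    exact: emeasurable_funD.
  rewrite -!mulrA EFinM lee_wpmul2l ?lee_fin//.
  rewrite ge0_integralD//; last 2 first.
    by move=> x _; rewrite lee_fin mulr_ge0.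
    by move=> x _; rewrite mule_ge0 ?lee_fin.
  rewrite mulrDl EFinD; apply: leeD.
    rewrite -/(mass (cst (F `^ v)) y r) (mass_cst qm)//.
    apply: (@le_trans _ _ ((F `^ v)%:E * (c * r `^ e)%:E)%E).
      by rewrite lee_wpmul2l ?lee_fin//; exact: (qm_ball_le qm).
    (* As [(1 - th) * v = q], the constant satisfies [F ^ v = k ^ v * t / r ^ e], and the volume of
       the ball removes [r ^ e]. *)
    rewrite -EFinM lee_fin /F powRM ?powR_ge0 ?(ltW k0)// -powRrM olsen_theta_exp// Sq.
    rewrite le_eqVlt; apply/orP; left; apply/eqP; field.
    by rewrite gt_eqF ?powR_gt0.
  rewrite ge0_integralZl_EFin//.
  rewrite -!mulrA EFinM lee_wpmul2l ?lee_fin//; apply: (le_trans (intP _ mg1 g10)).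
  rewrite EFinM lee_wpmul2l ?lee_fin//.
  apply: (@le_trans _ _ (mass (fun x => g x `^ q)%R y (4 * r))).
    apply: le_lower_integral => x _; first by rewrite lee_fin powR_ge0.
    rewrite lee_fin /g1 indicE; case: (_ \in _); rewrite ?mulr1// !mulr0 powR0//.
    by rewrite gt_eqF.
  apply: (le_trans (massq _ (lexx _))).
  by rewrite mulrK ?unitfE ?gt_eqF// mulrC.
move=> x lam xB lam0 lamJ; rewrite /M indicE mem_set// !mulr1.
(* Either the tail accounts for [lam], or the truncated potential is at least [lam / 2]. *)
have [lamF|Flam] := leP lam (2 * F).
  apply: (@le_trans _ _ ((2 `^ v)%:E * (F `^ v)%:E)%E).
    rewrite -EFinM lee_fin -powRM ?(ltW F0)//.
    by apply: ge0_ler_powR; rewrite ?nnegrE ?(ltW v0)// mulr_ge0// ltW.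
  by rewrite lee_wpmul2l ?lee_fin// leeDl// mule_ge0 ?lee_fin.
have lam2 : ((lam / 2)%:E <= potential g1 x)%E.
  rewrite leNgt; apply/negP => pj; have := le_trans lamJ (potF x xB).
  rewrite leNgt => /negP; apply.
  apply: (@lt_le_trans _ _ ((lam / 2)%:E + F%:E)%E); first by rewrite lteD2rE.
  rewrite -EFinD lee_fin; lra.
apply: (@le_trans _ _ ((2 `^ v)%:E * ((lam / 2) `^ v)%:E)%E).
  by rewrite -EFinM lee_fin -powRM ?divr_ge0// mulrC divfK.
rewrite lee_wpmul2l ?lee_fin//.
apply: (@le_trans _ _ (C1%:E * majorant g1 x)%E).
  by apply: powP => //; rewrite divr_ge0.
by rewrite leeDr// lee_fin.
Qed.


(* 1 / q = th / q + 1 / v. *)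
Lemma young_split (a b : R) : 0 <= a -> 0 <= b ->
  (a * b) `^ q <= a `^ (q / th) + b `^ v.
Proof.
move=> a0 b0; have q0 : 0 < q := lt_trans ltr01 q_gt1.
have th0 : 0 < th by exact: olsen_theta_gt0.
have th1 : 0 < 1 - th by rewrite subr_gt0; exact: olsen_theta_lt1.
have v0 : 0 < v by rewrite divr_gt0.
(* Each factor is compared with the sum: [a ^ q <= M ^ th] and [b ^ q <= M ^ (1 - th)]. *)
pose M := a `^ (q / th) + b `^ v.
have M0 : 0 <= M by rewrite addr_ge0 ?powR_ge0.
have M1 : M `^ th * M `^ (1 - th) = M.
  have th1E : th + (1 - th) = 1 by rewrite addrC subrK.
  by rewrite -powRD th1E ?powRr1// oner_eq0.
rewrite powRM// -[leRHS]M1; apply: ler_pM; rewrite ?powR_ge0//.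
  apply: (@le_trans _ _ ((a `^ (q / th)) `^ th)); first by rewrite -powRrM divfK ?gt_eqF.
  by apply: ge0_ler_powR; rewrite ?nnegrE ?powR_ge0 ?(ltW th0)// lerDl powR_ge0.
apply: (@le_trans _ _ ((b `^ v) `^ (1 - th))); first by rewrite -powRrM divfK ?gt_eqF.
by apply: ge0_ler_powR; rewrite ?nnegrE ?powR_ge0 ?(ltW th1)// lerDr powR_ge0.
Qed.

(** The pointwise inequality [young_split] is integrated with [M] in place of [j ^ v]; both terms on
    the right are then measurable, and their integrals may be added. *)
Lemma local_olsen A : 0 < A -> exists2 C, 0 < C & forall g,
  measurable_fun [set: T] g -> (forall x, 0 <= g x) -> morrey mu D e beta A g ->
  forall y r t, 0 < r -> 0 < t ->
  (forall u, 4 * r <= u -> (mass (fun x => g x `^ q)%R y u <= (t * (u / r) `^ e)%:E)%E) ->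
  forall w j : T -> R, measurable_fun [set: T] w -> (forall x, 0 <= w x) ->
  (forall x, 0 <= j x) -> (forall x, ((j x)%:E <= potential g x)%E) ->
  (mass (fun x => (w x * j x) `^ q)%R y r <=
    mass (fun x => w x `^ (q / th))%R y r + (C * t)%:E)%E.
Proof.
move=> A0; have [C C0 majP] := local_majorant A0.
exists C => // g mg g0 Mg y r t r0 t0 massq w j mw w0 j0 jle.
have [M [mM M0 intM Mj]] := majP g mg g0 Mg y r t r0 t0 massq.
have mws : measurable_fun [set: T] (fun x => (w x `^ (q / th) * \1_(B y r) x)%:E).
  apply: (measurable_integrand qm (g := fun x => w x `^ (q / th))).
  exact: (measurableT_comp (measurable_powR _)).
have wB0 x : (0 <= (w x `^ (q / th) * \1_(B y r) x)%:E)%E.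
  by rewrite lee_fin mulr_ge0 ?powR_ge0.
apply: le_trans (leeD2l _ intM).
rewrite /mass -ge0_integralD//.
apply: le_lower_integral => x _; first by rewrite lee_fin mulr_ge0 ?powR_ge0.
have [xB|xB] := pselect (B y r x); last first.
  by rewrite indicE memNset// !mulr0 add0e.
rewrite indicE mem_set// !mulr1; apply: le_trans (leeD2l _ (Mj x _ xB (j0 x) (jle x))).
by rewrite -EFinD lee_fin; exact: young_split.
Qed.

End local_strong_estimate.

(** * Dyadic sums of the growth function *)

Section dyadic_sum.
Context {R : realType}.
Local Notation leb := (@lebesgue_measure R).

Lemma dyadic_shell_inj (r t : R) (i k : nat) : 0 < r ->
  r * 2 ^+ i <= t < r * 2 ^+ i.+1 -> r * 2 ^+ k <= t < r * 2 ^+ k.+1 -> i = k.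
Proof.
move=> r0 /andP[it ti] /andP[kt tk].
have := le_lt_trans it tk; have := le_lt_trans kt ti.
rewrite !ltr_pM2l// !ltr_eXn2l ?ltr1n// !ltnS => ki ik.
by apply/eqP; rewrite eqn_leq ik ki.
Qed.

Variables (psi : R -> R) (q Cd C : R).
Hypotheses (q_gt0 : 0 < q) (Cd_gt0 : 0 < Cd) (C_gt0 : 0 < C).
Hypothesis psi_gt0 : forall r, 0 < r -> 0 < psi r.
Hypothesis psi_dec : forall r s, 0 < r -> r <= s -> psi s <= Cd * psi r.
Hypothesis psi_int : forall r, 0 < r ->
  (\int[leb]_(t in `[r, +oo[) (psi t `^ q * t^-1)%:E <= (C * psi r `^ q)%:E)%E.

(** On the interval from [rho k] to [2 * rho k] one has [psi t >= psi (2 * rho k) / Cd] and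
    [1 / t >= 1 / (2 * rho k)]. The interval has length [rho k], so it contributes at least half of
    [(psi (2 * rho k) / Cd) ^ q]; this gives the constant [2 * Cd ^ q * C]. *)
Lemma dyadic_sum_pow_le r n : 0 < r ->
  (\sum_(0 <= k < n) (psi (2 * (r * 2 ^+ k)) `^ q)%:E <=
    (2 * Cd `^ q * C * psi r `^ q)%:E)%E.
Proof.
move=> r0; pose rho k := r * 2 ^+ k.
have rho0 k : 0 < rho k by rewrite mulr_gt0// exprn_gt0.
have rhoS k : 2 * rho k = rho k.+1 by rewrite /rho exprS mulrCA.
pose X k : set R := `[rho k, rho k.+1[%classic.
pose a k := (Cd^-1 * psi (2 * rho k)) `^ q / (2 * rho k).
have a0 k : 0 <= a k.
  by rewrite mulr_ge0 ?powR_ge0// invr_ge0 mulr_ge0// ltW.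
have XP k t : X k t -> rho k <= t < rho k.+1 by rewrite /X /= in_itv.
have aX : (\sum_(0 <= k < n) (a k)%:E * leb (X k) <= (C * psi r `^ q)%:E)%E.
  apply: le_trans (psi_int r0).
  rewrite (eq_bigr (fun k => \int[leb]_(t in `[r, +oo[) (a k * \1_(X k) t)%:E)%E).
    rewrite -ge0_integral_sum//; last 2 first.
      move=> k; apply/measurable_EFinP/measurable_funM => //.
      by apply: measurable_indic; exact: measurable_itv.
      by move=> k t _; rewrite lee_fin mulr_ge0.
    apply: le_lower_integral => t.
      by move=> _; apply: sume_ge0 => k _; rewrite lee_fin mulr_ge0.
    rewrite /= in_itv/= andbT => rt; have t0 := lt_le_trans r0 rt.
    (* The intervals are disjoint, so at most one term of the sum is nonzero at [t]. *)
    have [[i [iX ilt]]|noX] := pselect (exists i, X i t /\ (i < n)%N).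
      rewrite (bigD1_seq i) ?mem_index_iota ?iota_uniq//= big1 ?adde0.
        rewrite lee_fin indicE mem_set// mulr1 /a; have /XP/andP[_ ti] := iX.
        have := psi_dec t0 (ltW ti); rewrite -rhoS => psit.
        apply: ler_pM; rewrite ?powR_ge0 ?invr_ge0 ?mulr_ge0 ?(ltW r0)//.
          apply: gt0_ler_powR; rewrite ?(ltW q_gt0) ?mulr_gt0 ?invr_gt0 ?psi_gt0 ?mulr_gt0//.
          by rewrite ler_pdivrMl.
        by rewrite rhoS lef_pV2 ?posrE// ltW.
      move=> k ki; rewrite indicE memNset ?mulr0// => /XP kX.
      by move: ki; rewrite (dyadic_shell_inj r0 (XP _ _ iX) kX) eqxx.
    rewrite big_nat_cond big1; last first.
      move=> k /andP[/andP[_ kn] _]; rewrite indicE memNset ?mulr0// => kX.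
      by apply: noX; exists k.
    by rewrite lee_fin mulr_ge0 ?powR_ge0// invr_ge0 ltW.
  move=> k _; under eq_integral do rewrite EFinM.
  rewrite ge0_integralZl_EFin//; last first.
    by apply/measurable_EFinP; apply: measurable_indic; exact: measurable_itv.
  rewrite integral_indic//; last exact: measurable_itv.
  congr (_ * leb _)%E.
  apply/esym/setIidl => t /XP/andP[rt _]; rewrite /= in_itv/= andbT.
  by apply: le_trans rt; rewrite ler_peMr ?(ltW r0)// exprn_ege1// ler1n.
have -> : (2 * Cd `^ q * C * psi r `^ q)%:E =
    ((2 * Cd `^ q)%:E * (C * psi r `^ q)%:E)%E by rewrite -EFinM mulrA.
apply: (@le_trans _ _ ((2 * Cd `^ q)%:E * \sum_(0 <= k < n) (a k)%:E * leb (X k))%E);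
  last first.
  by rewrite lee_pmul2l// lte_fin mulr_gt0 ?powR_gt0.
rewrite ge0_sume_distrr; last first.
  by move=> k _; rewrite mule_ge0 ?lee_fin.
apply: lee_sum => k _; rewrite /X lebesgue_measure_itv/= lte_fin.
have rk : rho k < rho k.+1 by rewrite -rhoS ltr_pMl ?ltr1n.
rewrite rk -EFinD -!EFinM lee_fin /a powRM ?invr_ge0 ?(ltW Cd_gt0)//; last first.
  by rewrite ltW// psi_gt0// mulr_gt0.
rewrite -powR_inv1 ?(ltW Cd_gt0)// powRAC powR_inv1 ?powR_ge0// -rhoS.
rewrite le_eqVlt; apply/orP; left; apply/eqP; rewrite -/(rho k).
have ? : rho k != 0 by rewrite gt_eqF.
have ? : Cd `^ q != 0 by rewrite gt_eqF ?powR_gt0.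
by field; apply/andP.
Qed.

(** The surplus power is taken out of the sum, since every term has
    [psi ^ (p - q) <= (Cd * psi r) ^ (p - q)]. *)
Lemma dyadic_series_pow_le p : q <= p -> exists2 K, 0 < K & forall r, 0 < r ->
  (\sum_(k <oo) (psi (2 * (r * 2 ^+ k)) `^ p)%:E <= (K * psi r `^ p)%:E)%E.
Proof.
move=> qp; exists (Cd `^ (p - q) * (2 * Cd `^ q * C)).
  by rewrite !mulr_gt0 ?powR_gt0.
move=> r r0.
have p0 k : 0 < 2 * (r * 2 ^+ k) by rewrite !mulr_gt0// exprn_gt0.
apply: lime_le.
  by apply: is_cvg_nneseries => k _ _; rewrite lee_fin powR_ge0.
apply: nearW => n /=.
apply: (@le_trans _ _ (((Cd * psi r) `^ (p - q))%:E *
    \sum_(0 <= k < n) (psi (2 * (r * 2 ^+ k)) `^ q)%:E)%E).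
  rewrite ge0_sume_distrr; last by move=> k _; rewrite lee_fin powR_ge0.
  apply: lee_sum => k _; rewrite -EFinM lee_fin -[in leLHS](subrK q p).
  rewrite [leLHS]powRD_gt0 ?psi_gt0// ler_wpM2r ?powR_ge0//.
  apply: gt0_ler_powR; rewrite ?psi_gt0 ?subr_ge0//; apply: psi_dec => //.
  by rewrite mulrCA ler_peMr ?(ltW r0)// -exprS exprn_ege1// ler1n.
apply: (@le_trans _ _ (((Cd * psi r) `^ (p - q))%:E * (2 * Cd `^ q * C * psi r `^ q)%:E)%E).
  by rewrite lee_wpmul2l ?lee_fin ?powR_ge0//; exact: dyadic_sum_pow_le.
rewrite -EFinM lee_fin powRM ?(ltW Cd_gt0) ?(ltW (psi_gt0 r0))//.
rewrite -[X in _ <= _ * _ `^ X](subrK q p) [X in _ <= _ * X]powRD_gt0 ?psi_gt0//.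
by rewrite le_eqVlt; apply/orP; left; apply/eqP; ring.
Qed.

End dyadic_sum.

(** * Bounds on amalgam norms *)

Section global_estimate.
Context {disp} {T : measurableType disp} {R : realType}.
Variables (mu : {sigma_finite_measure set T -> \bar R}) (D : T -> T -> R) (e c : R).
Hypothesis qm : regular_quasi_metric mu D e c.
Variables (gamma beta q : R).
Hypotheses (gamma_gt0 : 0 < gamma) (gamma_lt : gamma < e) (beta_lt : beta < - gamma)
  (q_gt1 : 1 < q).
Implicit Types (g w j : T -> R) (x y z : T) (r : R).

Local Notation B := (qball D).
Local Notation mass := (mass mu D).
Local Notation th := (olsen_theta gamma beta).
Local Notation potential := (potential mu D e gamma).

Lemma measurable_mass g r : measurable_fun [set: T] g -> (forall x, 0 <= g x) ->
  measurable_fun [set: T] (fun y => mass g y r).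
Proof.
move=> mg g0; pose F (u : T * T) := (g u.2 * \1_(B u.1 r) u.2)%:E.
apply: (@measurable_fun_fubini_tonelli_F _ _ _ _ _ mu F); last first.
  by move=> u; rewrite lee_fin mulr_ge0.
apply/measurable_EFinP/measurable_funM; first exact: measurableT_comp.
rewrite (_ : (fun u => _) = \1_[set u : T * T | D u.2 u.1 < r]); last first.
  by apply/funext => u; rewrite !indicE; congr (_%:R); congr nat_of_bool; apply/asboolP/asboolP.
apply: measurable_indic.
rewrite (_ : mkset _ = [set: T * T] `&` (fun u => D u.2 u.1) @^-1` `]-oo, r[).
  by apply: (measurable_dist qm) => //; exact: measurable_itv.
by apply/seteqP; split=> u /=; rewrite in_itv/=; [split|case].
Qed.

Let q_gt0 : 0 < q. Proof. exact: lt_trans q_gt1. Qed.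
Let e_gt0 : 0 < e. Proof. exact: qm_dim_gt0 qm. Qed.
Let c_gt0 : 0 < c. Proof. exact: qm_cst_gt0 qm. Qed.

Lemma poweR_add_le (a : R) (x y : \bar R) : 0 <= a -> (0 <= x)%E -> (0 <= y)%E ->
  ((x + y) `^ a <= (2 `^ a)%:E * (x `^ a + y `^ a))%E.
Proof.
move=> a0; wlog xy : x y / (x <= y)%E.
  move=> h x0 y0; have [xy|/ltW yx] := leP x y; first exact: h.
  by rewrite addeC [X in (_ <= _ * X)%E]addeC; exact: h.
move=> x0 y0; apply: (@le_trans _ _ ((2%:E * y) `^ a)%E).
  apply: gt0_ler_poweR => //.
  - by rewrite in_itv/= adde_ge0 ?leey.
  - by rewrite in_itv/= mule_ge0 ?leey// lee_fin.
  by rewrite mule_natl mule2n leeD2r.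
rewrite poweRM// ?lee_fin// poweR_EFin lee_wpmul2l ?lee_fin ?powR_ge0//.
by rewrite leeDr ?poweR_ge0.
Qed.

Lemma measurable_fun_powR g a : measurable_fun [set: T] g ->
  measurable_fun [set: T] (fun x => g x `^ a).
Proof. by move=> mg; exact: (measurableT_comp (measurable_powR _)). Qed.

(** This is [mass_pow_le] with [S = r ^ beta]. *)
Lemma morrey_of_mass_pow a g : measurable_fun [set: T] g -> (forall x, 0 <= g x) ->
  (forall x r, 0 < r ->
    (mass (fun z => g z `^ q)%R x r <= (a * ((r `^ beta) `^ q * r `^ e))%:E)%E) ->
  morrey mu D e beta (a + c) g.
Proof.
move=> mg g0 massq x r r0; rewrite powRD_gt0// (mulrC (r `^ e)) mulrA.
by apply: (mass_pow_le qm q_gt1) => //; [exact: powR_gt0|exact: massq].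
Qed.

Variables (phi : R -> R) (Cp : R).
Hypotheses (phi_gt0 : forall r, 0 < r -> 0 < phi r) (Cp_gt0 : 0 < Cp)
  (phi_le : forall r, 0 < r -> phi r <= Cp * r `^ beta).

Section finite_exponent.
Variables (p Cd Ci : R).
Hypotheses (le_qp : q <= p) (Cd_gt0 : 0 < Cd) (Ci_gt0 : 0 < Ci).

(** [psi] is the almost decreasing function attached to [phi], and [Phi r = psi r * r ^ (e / q)] is
    the bound at radius [r] on the amalgam norm of a function of Fofana norm at most 1. *)
Let psi r := phi r * r `^ (e / p).
Let Phi r := phi r * r `^ (e / q + e / p).

Hypotheses (psi_dec : forall r s, 0 < r -> r <= s -> psi s <= Cd * psi r)
  (psi_int : forall r, 0 < r ->
    (\int[lebesgue_measure]_(t in `[r, +oo[) (psi t `^ q * t^-1)%:E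
      <= (Ci * psi r `^ q)%:E)%E).

Let p_gt0 : 0 < p. Proof. exact: lt_le_trans le_qp. Qed.
Let pq_gt0 : 0 < p / q. Proof. exact: divr_gt0. Qed.
Let Phi_gt0 r : 0 < r -> 0 < Phi r.
Proof. by move=> r0; rewrite mulr_gt0 ?powR_gt0 ?phi_gt0. Qed.

(** The bound on the amalgam norm raised to the power [p], with [g] the [q]-th power of the
    function. For the weight the exponents [q / th] and [p / th] have the same ratio, and [Phi ^ th]
    to the power [p / th] is again [Phi ^ p]; so one condition serves for [|f| ^ q] and
    [|W| ^ s]. *)
Definition global_bound g := forall r, 0 < r ->
  (\int[mu]_y (mass g y r `^ (p / q)) <= (Phi r `^ p)%:E)%E.

(* Balls of radius r centered in B x r and doubled contain B x r, so the norm in y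
   controls the mass at every center. *)
Lemma global_bound_mass_le : exists2 a, 0 < a & forall g,
  (forall x, 0 <= g x) -> global_bound g ->
  forall x r, 0 < r -> (mass g x r <= (a * ((r `^ beta) `^ q * r `^ e))%:E)%E.
Proof.
(* The power bound on [phi] gives [Phi u <= Cp * u ^ eta]. Dividing by the volume and taking the
   power [q / p] leaves the exponent [(eta * p - e) * (q / p) = beta * q + e]. *)
pose eta := beta + (e / q + e / p).
exists (c `^ (q / p) * (Cp * 2 `^ eta) `^ q).
  by rewrite mulr_gt0 ?powR_gt0 ?mulr_gt0 ?powR_gt0.
move=> g g0 gb x r r0; have r20 : 0 < 2 * r by rewrite mulr_gt0.
have M0 : (0 <= mass g x r)%E by exact: mass_ge0.
have mB := measurable_qball qm x r.
have avg : (mass g x r `^ (p / q) * (c^-1 * r `^ e)%:E <= ((Cp * (2 * r) `^ eta) `^ p)%:E)%E.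
  apply: (@le_trans _ _ (mass g x r `^ (p / q) * mu (B x r))%E).
    by rewrite lee_wpmul2l ?poweR_ge0//; exact: (qm_ball_ge qm).
  apply: (@le_trans _ _ (Phi (2 * r) `^ p)%:E); last first.
    rewrite lee_fin; apply: gt0_ler_powR; rewrite ?(ltW p_gt0) ?Phi_gt0//.
    by rewrite /eta powRD_gt0// mulrA ler_wpM2r ?powR_ge0// phi_le.
  apply: le_trans (gb _ r20).
  have -> : mu (B x r) = (\int[mu]_y (\1_(B x r) y)%:E)%E by rewrite integral_indic// setIT.
  rewrite -ge0_integralZl//; last 2 first.
    by apply/measurable_EFinP; exact: measurable_indic.
    exact: poweR_ge0.
  apply: le_lower_integral => y _; first by rewrite mule_ge0 ?poweR_ge0 ?lee_fin.
  have [yB|yB] := pselect (B x r y); last first.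
    by rewrite indicE memNset// mule0 poweR_ge0.
  rewrite indicE mem_set// mule1; apply: gt0_ler_poweR.
  - exact: ltW.
  - by rewrite in_itv/= M0 leey.
  - by rewrite in_itv/= mass_ge0// leey.
  by apply: (mass_slide qm).
have powM : (mass g x r `^ (p / q) <= (c * r `^ (- e) * (Cp * (2 * r) `^ eta) `^ p)%:E)%E.
  have k0 : 0 < c * r `^ (- e) by rewrite mulr_gt0 ?powR_gt0.
  rewrite EFinM; apply: le_trans (lee_wpmul2l _ avg); last by rewrite lee_fin ltW.
  rewrite muleCA -EFinM powRN [X in (_ * X%:E)%E](_ : _ = 1) ?mule1//.
  by field; rewrite !gt_eqF ?powR_gt0.
have -> : mass g x r = ((mass g x r `^ (p / q)) `^ (q / p))%E.
  by rewrite -poweRrM mulrA divfK ?gt_eqF// divff ?poweRe1// gt_eqF.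
apply: (@le_trans _ _ ((c * r `^ (- e) * (Cp * (2 * r) `^ eta) `^ p)%:E `^ (q / p))%E).
  apply: gt0_ler_poweR => //; first by rewrite divr_ge0 ?ltW.
  - by rewrite in_itv/= poweR_ge0 leey.
  - by rewrite in_itv/= leey lee_fin !mulr_ge0 ?powR_ge0 ?ltW.
rewrite poweR_EFin lee_fin le_eqVlt; apply/orP; left; apply/eqP.
have Cp2 : 0 <= Cp * 2 `^ eta by rewrite mulr_ge0 ?powR_ge0 ?(ltW Cp_gt0).
have pE : p * (q / p) = q by rewrite mulrC divfK// gt_eqF.
have -> : (Cp * (2 * r) `^ eta) `^ p = (Cp * 2 `^ eta) `^ p * r `^ (eta * p).
  by rewrite (powRM _ (ler0n _ 2) (ltW r0)) mulrA (powRM _ Cp2 (powR_ge0 _ _)) -powRrM.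
have -> : c * r `^ (- e) * ((Cp * 2 `^ eta) `^ p * r `^ (eta * p)) =
    c * (Cp * 2 `^ eta) `^ p * (r `^ (- e) * r `^ (eta * p)) by ring.
rewrite -powRD_gt0// (powRM _ (mulr_ge0 (ltW c_gt0) (powR_ge0 _ _)) (powR_ge0 _ _)).
rewrite (powRM _ (ltW c_gt0) (powR_ge0 _ _)) -!powRrM pE.
congr (_ * _); rewrite -!powRD_gt0//; congr (_ `^ _).
by rewrite /eta; field; rewrite !gt_eqF.
Qed.

(** The local estimate needs one number [t] for all radii from [4 * r] on, that is, a supremum over
    dyadic scales. It is replaced by the [n]-th root of the sum [V y] of [n]-th powers, with
    [n = p / q]; this sum can be integrated in [y] term by term. *)
Lemma global_olsen_finite : exists2 K, 0 < K & forall g w j,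
  measurable_fun [set: T] g -> (forall x, 0 <= g x) ->
  measurable_fun [set: T] w -> (forall x, 0 <= w x) ->
  (forall x, 0 <= j x) -> (forall x, ((j x)%:E <= potential g x)%E) ->
  global_bound (fun x => g x `^ q) -> global_bound (fun x => w x `^ (q / th)) ->
  forall r, 0 < r ->
  (\int[mu]_y (mass (fun x => (w x * j x) `^ q)%R y r `^ (p / q)) <= (K * Phi r `^ p)%:E)%E.
Proof.
have [a a0 massP] := global_bound_mass_le.
have [C C0 localP] := local_olsen qm gamma_gt0 gamma_lt beta_lt q_gt1 (addr_gt0 a0 c_gt0).
have psi_gt0 r : 0 < r -> 0 < psi r by move=> r0; rewrite mulr_gt0 ?powR_gt0 ?phi_gt0.
have [K1 K10 seriesP] := dyadic_series_pow_le q_gt0 Cd_gt0 Ci_gt0 psi_gt0 psi_dec psi_int le_qp.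
pose n := p / q.
have n0 : 0 < n by [].
exists (2 `^ n * (1 + C `^ n * (8 `^ (e * n) * (K1 * Cd `^ p)))).
  by rewrite !mulr_gt0 ?addr_gt0 ?mulr_gt0 ?powR_gt0.
move=> g w j mg g0 mw w0 j0 jle gb wb r r0.
have gq0 x : 0 <= g x `^ q by exact: powR_ge0.
have ws0 x : 0 <= w x `^ (q / th) by exact: powR_ge0.
have Mg : morrey mu D e beta (a + c) g.
  by apply: morrey_of_mass_pow => // x u u0; exact: massP.
have r40 : 0 < 4 * r by rewrite mulr_gt0.
(* The upper end of the dyadic shell [k] starting from [4 * r]. *)
pose rho k := 2 * (4 * r * 2 ^+ k).
have rho0 k : 0 < rho k by rewrite !mulr_gt0// exprn_gt0.
pose m k y := mass (fun x => g x `^ q)%R y (rho k).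
have m0 k y : (0 <= m k y)%E by exact: mass_ge0.
pose s k : R := (2 ^+ k) `^ (- e).
have s0 k : 0 < s k by rewrite powR_gt0 ?exprn_gt0.
pose V y := (\sum_(k <oo) ((s k)%:E * m k y) `^ n)%E.
have V0 y : (0 <= V y)%E by apply: nneseries_ge0 => k _ _; exact: poweR_ge0.
pose omega y := mass (fun x => w x `^ (q / th))%R y r.
have omega0 y : (0 <= omega y)%E by exact: mass_ge0.
have le_pow (x y : \bar R) : (0 <= x)%E -> (x <= y)%E -> (x `^ n <= y `^ n)%E.
  move=> x0 xy; apply: gt0_ler_poweR => //; rewrite ?(ltW n0)//.
  - by rewrite in_itv/= x0 leey.
  - by rewrite in_itv/= (le_trans x0 xy) leey.
have pointwise y : (mass (fun x => (w x * j x) `^ q)%R y r `^ n <=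
    (2 `^ n)%:E * (omega y `^ n + (C `^ n)%:E * V y))%E.
  have [Vy|Vy] := eqVneq (V y) +oo%E.
    rewrite Vy gt0_muley ?lte_fin ?powR_gt0// addey ?gt0_muley ?lte_fin ?powR_gt0 ?leey//.
    by rewrite gt_eqF// (lt_le_trans _ (poweR_ge0 _ _)).
  have Vfin : V y \is a fin_num by rewrite ge0_fin_numE// ltey.
  apply/lee_addgt0Pr => eps eps0.
  (* The local estimate requires [t > 0] while [V y] may vanish. The added term is scaled so that it
     costs exactly [eps] in the end. *)
  pose b := fine (V y) + eps / (2 `^ n * C `^ n).
  have b0 : 0 < b.
    by rewrite ltr_wpDl ?fine_ge0// divr_gt0// mulr_gt0 ?powR_gt0.
  have Vb : (V y <= b%:E)%E.
    rewrite -(fineK Vfin) lee_fin lerDl ltW// divr_gt0// mulr_gt0 ?powR_gt0//.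
  pose t := b `^ n^-1.
  have t0 : 0 < t by rewrite powR_gt0.
  (* A single term of the series is at most [V y <= b], whence the bound by [t] after taking the
     [n]-th root. *)
  have smt k : ((s k)%:E * m k y <= t%:E)%E.
    have sm0 : (0 <= (s k)%:E * m k y)%E by rewrite mule_ge0// lee_fin ltW.
    have -> : ((s k)%:E * m k y = (((s k)%:E * m k y) `^ n) `^ n^-1)%E.
      by rewrite -poweRrM mulfV ?gt_eqF// poweRe1.
    rewrite /t -poweR_EFin; apply: gt0_ler_poweR.
    - by rewrite invr_ge0 ltW.
    - by rewrite in_itv/= poweR_ge0 leey.
    - by rewrite in_itv/= lee_fin (ltW b0) leey.
    apply: le_trans Vb; apply: (nneseries_ge_term k) => i; exact: poweR_ge0.
  have massu u : 4 * r <= u ->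
      (mass (fun x => g x `^ q)%R y u <= (t * (u / r) `^ e)%:E)%E.
    move=> ru; have := @dyadic_shell_ge1 _ (u / (4 * r)).
    rewrite ler_pdivlMr// mul1r => /(_ ru)[k /andP[ku uk]].
    have u_rho : u <= rho k.
      have -> : rho k = 2 * 2 ^+ k * (4 * r) by rewrite /rho; ring.
      by rewrite -ler_pdivrMr// ltW.
    apply: (@le_trans _ _ (m k y)).
      apply: le_lower_integral => x _; rewrite lee_fin; first by rewrite mulr_ge0.
      rewrite ler_wpM2l// !(qball_indE D); have [xu|] := boolP (D x y < u); last by rewrite ler0n.
      by rewrite (lt_le_trans xu u_rho).
    apply: (@le_trans _ _ (((2 ^+ k) `^ e)%:E * ((s k)%:E * m k y))%E).
      rewrite muleA -EFinM -powRD_gt0 ?exprn_gt0// addrN powRr0 mul1e//.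
    rewrite mulrC EFinM; apply: (@le_trans _ _ (((2 ^+ k) `^ e)%:E * t%:E)%E).
      by rewrite lee_wpmul2l// lee_fin powR_ge0.
    rewrite -!EFinM lee_fin ler_wpM2r ?(ltW t0)//.
    apply: gt0_ler_powR; rewrite ?exprn_gt0 ?(ltW e_gt0)//.
    apply: (le_trans ku); rewrite ler_pM2l ?(lt_le_trans r40)// lef_pV2 ?posrE//.
    by rewrite ler_peMl ?(ltW r0)// ler1n.
  apply: (le_trans (le_pow _ _ _ (localP g mg g0 Mg y r t r0 t0 massu w j mw w0 j0 jle))).
    by apply: mass_ge0 => x; exact: powR_ge0.
  have Ct0 : (0 <= (C * t)%:E)%E by rewrite lee_fin mulr_ge0 ?ltW.
  apply: (le_trans (poweR_add_le (ltW n0) (omega0 y) Ct0)).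
  rewrite -/(omega y) poweR_EFin powRM ?(ltW C0) ?(ltW t0)// /t powRrV ?gt_eqF ?(ltW b0)//.
  rewrite -(fineK Vfin) -EFinM !ge0_muleDr ?poweR_ge0 ?lee_fin ?mulr_ge0 ?powR_ge0
    ?fine_ge0 ?(ltW b0)//.
  rewrite -addeA -!EFinM -EFinD leeD2l// lee_fin /b mulrDr mulrDr lerD2l.
  rewrite le_eqVlt; apply/orP; left; apply/eqP; field.
  by rewrite !gt_eqF ?powR_gt0.
have mm k : measurable_fun [set: T] (m k).
  by apply: measurable_mass => //; exact: measurable_fun_powR.
have mo : measurable_fun [set: T] omega.
  by apply: measurable_mass => //; exact: measurable_fun_powR.
have mpow (h : T -> \bar R) : measurable_fun [set: T] h ->
    measurable_fun [set: T] (fun y => h y `^ n)%E.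
  by move=> mh; exact: (measurableT_comp (measurable_poweR _)).
have msm k : measurable_fun [set: T] (fun y => ((s k)%:E * m k y) `^ n)%E.
  by apply: mpow; exact: measurable_funeM.
have mV : measurable_fun [set: T] V.
  by apply: ge0_emeasurable_sum => // *; exact: poweR_ge0.
have IV : (\int[mu]_y V y <= (8 `^ (e * n) * (K1 * Cd `^ p) * Phi r `^ p)%:E)%E.
  rewrite integral_nneseries//; last by move=> k y _; exact: poweR_ge0.
  pose r8 := (8 * r) `^ (e * n).
  apply: (@le_trans _ _ (\sum_(k <oo) r8%:E * (psi (rho k) `^ p)%:E)%E).
    apply: lee_nneseries => [k _ _|k _]; first by apply: integral_ge0 => y _; exact: poweR_ge0.
    under eq_integral do rewrite poweRM ?lee_fin ?(ltW (s0 k))//.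
    rewrite poweR_EFin ge0_integralZl_EFin ?powR_ge0//; last 2 first.
      by move=> y _; exact: poweR_ge0.
      exact: mpow.
    apply: (@le_trans _ _ ((s k `^ n)%:E * (Phi (rho k) `^ p)%:E)%E).
      by rewrite lee_wpmul2l ?lee_fin ?powR_ge0//; exact: gb.
    (* The decay [s k ^ n] cancels the factor [(2 ^ k) ^ (e * n)] in [Phi (rho k) ^ p]. What remains
       is [(8 * r) ^ (e * n) * psi (rho k) ^ p], the term of the dyadic series of [psi] started at
       [4 * r]. *)
    rewrite -!EFinM lee_fin le_eqVlt; apply/orP; left; apply/eqP.
    have -> : Phi (rho k) = psi (rho k) * rho k `^ (e / q).
      by rewrite /Phi /psi addrC powRD_gt0// mulrA.
    have rE : rho k = 8 * r * 2 ^+ k by rewrite /rho; ring.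
    rewrite (powRM _ (ltW (psi_gt0 _ (rho0 k))) (powR_ge0 _ _)) -powRrM.
    have -> : e / q * p = e * n by rewrite /n; ring.
    rewrite [rho k `^ (e * n)](_ : _ = r8 * (2 ^+ k) `^ (e * n)); last first.
      by rewrite rE powRM ?exprn_ge0// mulr_ge0// ltW.
    rewrite /s -powRrM mulNr powRN; field.
    by rewrite gt_eqF// powR_gt0// exprn_gt0.
  rewrite nneseriesZl; last by move=> k _; rewrite lee_fin powR_ge0.
  apply: (@le_trans _ _ (r8%:E * (K1 * psi (4 * r) `^ p)%:E)%E).
    by rewrite lee_wpmul2l ?lee_fin ?powR_ge0//; exact: seriesP.
  have p4 : psi (4 * r) `^ p <= (Cd * psi r) `^ p.
    apply: gt0_ler_powR; rewrite ?psi_gt0 ?(ltW p_gt0)//; apply: psi_dec => //.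
    by rewrite ler_peMl ?(ltW r0)// ler1n.
  rewrite -EFinM lee_fin; apply: (@le_trans _ _ (r8 * (K1 * (Cd * psi r) `^ p))).
    by rewrite ler_wpM2l ?powR_ge0// ler_wpM2l ?(ltW K10).
  rewrite le_eqVlt; apply/orP; left; apply/eqP.
  have -> : Phi r = psi r * r `^ (e / q) by rewrite /Phi /psi addrC powRD_gt0// mulrA.
  rewrite (powRM _ (ltW (psi_gt0 _ r0)) (powR_ge0 _ _)) (powRM _ (ltW Cd_gt0) (ltW (psi_gt0 _ r0))).
  rewrite -powRrM.
  have -> : e / q * p = e * n by rewrite /n; ring.
  rewrite /r8 (powRM _ (ler0n _ 8) (ltW r0)); ring.
apply: (@le_trans _ _ (\int[mu]_y ((2 `^ n)%:E * (omega y `^ n + (C `^ n)%:E * V y)))%E).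
  by apply: le_lower_integral => y _; [exact: poweR_ge0|exact: pointwise].
have CV0 y : (0 <= (C `^ n)%:E * V y)%E by rewrite mule_ge0// lee_fin powR_ge0.
have on0 y : (0 <= omega y `^ n)%E by exact: poweR_ge0.
have mCV : measurable_fun [set: T] (fun y => (C `^ n)%:E * V y)%E by exact: measurable_funeM.
have mon : measurable_fun [set: T] (fun y => omega y `^ n)%E by exact: mpow.
rewrite ge0_integralZl_EFin ?powR_ge0//; last 2 first.
  by move=> y _; rewrite adde_ge0.
  exact: emeasurable_funD.
rewrite -mulrA EFinM lee_wpmul2l ?lee_fin ?powR_ge0//.
rewrite ge0_integralD// ge0_integralZl_EFin ?powR_ge0//.
rewrite mulrDl mul1r EFinD; apply: leeD; first exact: wb.
by rewrite -mulrA EFinM lee_wpmul2l ?lee_fin ?powR_ge0.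
Qed.


End finite_exponent.

End global_estimate.

(** * The case p = oo *)

Section global_estimate_infinite.
Context {disp} {T : measurableType disp} {R : realType}.
Variables (mu : {sigma_finite_measure set T -> \bar R}) (D : T -> T -> R) (e c : R).
Hypothesis qm : regular_quasi_metric mu D e c.
Variables (gamma beta q : R).
Hypotheses (gamma_gt0 : 0 < gamma) (gamma_lt : gamma < e) (beta_lt : beta < - gamma)
  (q_gt1 : 1 < q).
Implicit Types (g w j : T -> R) (x y z : T) (r : R).

Local Notation B := (qball D).
Local Notation mass := (mass mu D).
Local Notation th := (olsen_theta gamma beta).
Local Notation potential := (potential mu D e gamma).

Let q_gt0 : 0 < q. Proof. exact: lt_trans q_gt1. Qed.
Let e_gt0 : 0 < e. Proof. exact: qm_dim_gt0 qm. Qed.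
Let c_gt0 : 0 < c. Proof. exact: qm_cst_gt0 qm. Qed.

Variables (phi : R -> R) (Cp Cd : R).
Hypotheses (phi_gt0 : forall r, 0 < r -> 0 < phi r) (Cp_gt0 : 0 < Cp) (Cd_gt0 : 0 < Cd)
  (phi_le : forall r, 0 < r -> phi r <= Cp * r `^ beta)
  (phi_dec : forall r s, 0 < r -> r <= s -> phi s <= Cd * phi r).

Let Phi r := phi r * r `^ (e / q).

Definition global_ess_bound g := forall r, 0 < r ->
  {ae mu, forall y, (mass g y r <= (Phi r `^ q)%:E)%E}.

Let PhiE r : 0 < r -> Phi r `^ q = phi r `^ q * r `^ e.
Proof.
by move=> r0; rewrite powRM ?powR_ge0 ?(ltW (phi_gt0 r0))// -powRrM divfK// gt_eqF.
Qed.

(** The ball [B x r] has positive measure, so it contains a centre [y] outside the exceptional null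
    set; the mass at [x] is at most the mass at [y] with doubled radius. *)
Lemma global_ess_bound_mass_le g : (forall x, 0 <= g x) -> global_ess_bound g ->
  forall x r, 0 < r -> (mass g x r <= (phi (2 * r) `^ q * (2 * r) `^ e)%:E)%E.
Proof.
move=> g0 gb x r r0; have r20 : 0 < 2 * r by rewrite mulr_gt0.
have [N [mN N0 subN]] := gb _ r20.
have [y [yB yN]] : exists y, B x r y /\ ~ N y.
  apply: contrapT => noy; have BN : B x r `<=` N.
    by move=> y yB; apply: contrapT => yN; apply: noy; exists y.
  have : (mu (B x r) <= mu N)%E.
    by apply: le_measure; rewrite ?inE//; exact: (measurable_qball qm).
  rewrite N0 leNgt => /negP; apply; apply: lt_le_trans (qm_ball_ge qm x r0).
  by rewrite lte_fin mulr_gt0 ?invr_gt0 ?powR_gt0.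
apply: (le_trans (mass_slide qm g0 yB)); rewrite -PhiE//.
by apply: contrapT => h; apply: yN; exact: subN.
Qed.

(** The masses of [g ^ q] are now bounded at every centre, and almost monotonicity of [phi] bounds
    all scales above [4 * r] by one [t] that does not depend on [y]. Only the bound on [w] leaves an
    exceptional null set. *)
Lemma global_olsen_infinite : exists2 K, 0 < K & forall g w j,
  measurable_fun [set: T] g -> (forall x, 0 <= g x) ->
  measurable_fun [set: T] w -> (forall x, 0 <= w x) ->
  (forall x, 0 <= j x) -> (forall x, ((j x)%:E <= potential g x)%E) ->
  global_ess_bound (fun x => g x `^ q) -> global_ess_bound (fun x => w x `^ (q / th)) ->
  forall r, 0 < r ->
  {ae mu, forall y, (mass (fun x => (w x * j x) `^ q)%R y r <= (K * Phi r `^ q)%:E)%E}.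
Proof.
(* From [phi (2 * u) ^ q * (2 * u) ^ e] with [phi (2 * u) <= Cp * (2 * u) ^ beta]. *)
pose a := Cp `^ q * 2 `^ (beta * q) * 2 `^ e.
have a0 : 0 < a by rewrite !mulr_gt0 ?powR_gt0.
have [C C0 localP] := local_olsen qm gamma_gt0 gamma_lt beta_lt q_gt1 (addr_gt0 a0 c_gt0).
exists (1 + C * (Cd `^ q * 2 `^ e)).
  by rewrite addr_gt0 ?mulr_gt0 ?powR_gt0.
move=> g w j mg g0 mw w0 j0 jle gb wb r r0.
have gq0 x : 0 <= g x `^ q by exact: powR_ge0.
have massP := global_ess_bound_mass_le gq0 gb.
have Mg : morrey mu D e beta (a + c) g.
  apply: (morrey_of_mass_pow qm q_gt1) => // x u u0; apply: (le_trans (massP x u u0)).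
  have u20 : 0 < 2 * u by rewrite mulr_gt0.
  rewrite lee_fin; apply: (@le_trans _ _ ((Cp * (2 * u) `^ beta) `^ q * (2 * u) `^ e)).
    rewrite ler_wpM2r ?powR_ge0//; apply: gt0_ler_powR; rewrite ?phi_gt0 ?(ltW q_gt0)//.
    exact: phi_le.
  rewrite (powRM _ (ltW Cp_gt0) (powR_ge0 _ _)) -powRrM !(powRM _ (ler0n _ 2) (ltW u0)).
  rewrite -powRrM le_eqVlt; apply/orP; left; apply/eqP; rewrite /a; ring.
have Phi0 : 0 < Phi r `^ q by rewrite powR_gt0// mulr_gt0 ?powR_gt0 ?phi_gt0.
(* From [phi (2 * u) <= Cd * phi r] and [Phi r ^ q = phi r ^ q * r ^ e]; the factor [2 ^ e] comes
   from the doubled radius. *)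
pose t := Cd `^ q * 2 `^ e * Phi r `^ q.
have t0 : 0 < t by rewrite mulr_gt0// mulr_gt0 ?powR_gt0.
have massu y u : 4 * r <= u ->
    (mass (fun x => g x `^ q)%R y u <= (t * (u / r) `^ e)%:E)%E.
  move=> ru; have u0 : 0 < u by apply: lt_le_trans ru; rewrite mulr_gt0.
  apply: (le_trans (massP y u u0)); rewrite lee_fin.
  apply: (@le_trans _ _ ((Cd * phi r) `^ q * (2 * u) `^ e)).
    rewrite ler_wpM2r ?powR_ge0//; apply: gt0_ler_powR.
    - by rewrite phi_gt0// mulr_gt0.
    - by apply: phi_dec => //; lra.
    - exact: ltW.
  rewrite (powRM _ (ltW Cd_gt0) (ltW (phi_gt0 r0))) (powRM _ (ler0n _ 2) (ltW u0)).
  have ur0 : 0 <= u / r by rewrite divr_ge0 ?(ltW r0) ?(ltW u0).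
  have -> : u `^ e = (u / r) `^ e * r `^ e by rewrite -powRM ?(ltW r0)// divfK ?gt_eqF.
  by rewrite /t PhiE// le_eqVlt; apply/orP; left; apply/eqP; ring.
have := wb r r0; apply: filterS => y wy.
have := localP g mg g0 Mg y r t r0 t0 (massu y) w j mw w0 j0 jle.
move=> /le_trans; apply; rewrite mulrDl mul1r EFinD; apply: leeD => //.
by rewrite lee_fin /t mulrA.
Qed.

End global_estimate_infinite.

(** * Euclidean space as a regular quasi-metric space *)

(** Sigma-finiteness is what Tonelli's theorem asks of the completed measure. *)
HB.instance Definition _ (R : realType) (d : nat) :=
  @Measure_isSigmaFinite.Build _ _ _ (@lebesgue_measure_Rd R d)
    (@completed_measure_extension_sigma_finite _ _ _ (@borel_lebesgue R d)
      (sigma_finiteT (@borel_lebesgue R d))).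

Section euclidean.
Context {R : realType} {d : nat}.
Implicit Types (x y z : Rd R d) (r : R).
Local Notation coord := (@Defs.coord R d).
Local Notation edist := (@Defs.edist R d).
Local Notation eball := (@Defs.eball R d).

Lemma measurable_Rd (A : set (d.-tuple (measurableTypeR R))) : measurable A ->
  measurable (A : set (Rd R d)).
Proof. exact: caratheodory_measurable_mu_ext. Qed.

Lemma measurable_coord i : measurable_fun [set: Rd R d] (fun x => coord x i).
Proof.
move=> _ Y mY; rewrite setTI; apply: measurable_Rd.
by rewrite -[X in measurable X]setTI; exact: (measurable_tnth i).
Qed.

Lemma edist_ge0 x y : 0 <= edist x y.
Proof. exact: sqrtr_ge0. Qed.

Lemma edist_sym x y : edist x y = edist y x.
Proof.
by congr Num.sqrt; apply: eq_bigr => i _; rewrite -sqrrN opprB.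
Qed.

Let sqd x y := \sum_(i < d) (coord x i - coord y i) ^+ 2.

Let sqd_ge0 x y : 0 <= sqd x y.
Proof. by apply: sumr_ge0 => i _; exact: sqr_ge0. Qed.

Lemma edist_sqr x y : edist x y ^+ 2 = sqd x y.
Proof. by rewrite /Defs.edist sqr_sqrtr//; exact: sqd_ge0. Qed.

(** In each coordinate [2 * (a - b) ^ 2 + 2 * (b - e) ^ 2 - (a - e) ^ 2] is the square of
    [a - 2 * b + e]. Summation bounds the squared distance by [4 * M ^ 2]. *)
Lemma edist_quasi_triangle x y z :
  edist x z <= 2 * Num.max (edist x y) (edist y z).
Proof.
set M := Num.max _ _.
have xM : edist x y <= M by rewrite le_max lexx.
have yM : edist y z <= M by rewrite le_max lexx orbT.
have M0 : 0 <= M by apply: le_trans xM; exact: edist_ge0.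
rewrite -(@ler_pXn2r _ 2) ?nnegrE ?edist_ge0 ?mulr_ge0// edist_sqr.
have sq : sqd x z <= 2 * sqd x y + 2 * sqd y z.
  rewrite /sqd !mulr_sumr -big_split/=; apply: ler_sum => i _.
  rewrite -subr_ge0; set a := coord x i; set b := coord y i; set e := coord z i.
  by rewrite (_ : _ - _ = (a - 2 * b + e) ^+ 2) ?sqr_ge0//; ring.
have sM u v : edist u v <= M -> sqd u v <= M ^+ 2.
  by move=> uM; rewrite -edist_sqr ler_pXn2r// ?nnegrE// edist_ge0.
apply: (le_trans sq); rewrite exprMn; have := sM _ _ xM; have := sM _ _ yM.
by lra.
Qed.

Lemma measurable_edist :
  measurable_fun [set: Rd R d * Rd R d] (fun u => edist u.1 u.2).
Proof.
rewrite (_ : (fun u => _) = (fun u => sqd u.1 u.2 `^ 2^-1)); last first.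
  by apply/funext => u; rewrite powR12_sqrt//; exact: sqd_ge0.
apply: (measurableT_comp (measurable_powR _)).
rewrite /sqd; apply: measurable_sum => i; apply: measurable_funX; apply: measurable_funB.
  exact: (measurableT_comp (measurable_coord i)).
exact: (measurableT_comp (measurable_coord i)).
Qed.

Lemma measurable_eball y r : measurable (eball y r).
Proof.
rewrite /Defs.eball (_ : mkset _ = [set: Rd R d] `&` (fun x => edist x y) @^-1` `]-oo, r[).
  have mD : measurable_fun [set: Rd R d] (fun x => edist x y).
    exact: (measurableT_comp measurable_edist (measurable_pair2 y)).
  by apply: mD => //; exact: measurable_itv.
by apply/seteqP; split=> x /=; rewrite in_itv/=; [split|case].
Qed.

(** Cubes are boxes, so their measure is a product of lengths; balls are only compared with them. *)
Definition cube y r : set (Rd R d) :=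
  [set x | forall i, `|coord x i - coord y i| < r].

Let cubeE y r : cube y r =
  [set t | forall i, `](coord y i - r), (coord y i + r)[%classic (tnth t i)].
Proof.
apply/seteqP; split => x /= h i; have := h i; rewrite /= in_itv/= /coord.
  by rewrite ltr_distl.
by rewrite -ltr_distl.
Qed.

Let measurable_slab y r (i : 'I_d) :
  measurable (`](coord y i - r), (coord y i + r)[%classic : set (measurableTypeR R)).
Proof. exact: measurable_itv. Qed.

Let borel_cube y r : measurable (cube y r : set (d.-tuple (measurableTypeR R))).
Proof.
rewrite cubeE.
rewrite (_ : mkset _ = \bigcap_(i in [set: 'I_d])
    ((fun t : d.-tuple (measurableTypeR R) => tnth t i) @^-1`
       `](coord y i - r), (coord y i + r)[%classic)); last first.
  by apply/seteqP; split => t /= h i => [_|]; [exact: h|exact: (h i I)].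
apply: fin_bigcap_measurable => // i _; rewrite -[X in measurable X]setTI.
by apply: measurable_tnth => //; exact: measurable_slab.
Qed.

Lemma measurable_cube y r : measurable (cube y r).
Proof. exact: measurable_Rd. Qed.

Lemma lebesgue_measure_cube y r : 0 < r ->
  lebesgue_measure_Rd (cube y r) = ((2 * r) ^+ d)%:E.
Proof.
move=> r0; rewrite lebesgue_measure_Rd_borel// cubeE.
rewrite (borel_lebesgue_box (measurable_slab y r)).
rewrite (eq_bigr (fun=> (2 * r)%:E)).
  by rewrite -(big_morph EFin EFinM erefl) prodr_const card_ord.
move=> i _; rewrite lebesgue_measure_itv/= lte_fin ifT; last by lra.
by rewrite -EFinB; congr EFin; ring.
Qed.

Lemma eball_sub_cube y r : eball y r `<=` cube y r.
Proof.
move=> x; rewrite /Defs.eball/= => xy i; apply: le_lt_trans xy.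
rewrite -(@ler_pXn2r _ 2) ?nnegrE ?edist_ge0// edist_sqr real_normK ?num_real//.
by rewrite /sqd (bigD1 i)//= lerDl sumr_ge0// => k _; exact: sqr_ge0.
Qed.

(** The crude bound [d * rho ^ 2 < d ^ 2 * (2 * rho) ^ 2 = r ^ 2], in which the factor 2 secures
    strictness when [d = 1]. *)
Lemma cube_sub_eball y r : (0 < d)%N -> 0 < r -> cube y (r / (2 * d%:R)) `<=` eball y r.
Proof.
move=> d0 r0 x xc; have dR : 1 <= d%:R :> R by rewrite ler1n.
rewrite /Defs.eball/= -(@ltr_pXn2r _ 2) ?nnegrE ?edist_ge0 ?(ltW r0)// edist_sqr.
set rho := r / (2 * d%:R) in xc.
have rho0 : 0 < rho by rewrite divr_gt0// mulr_gt0// (lt_le_trans ltr01).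
apply: (@le_lt_trans _ _ (\sum_(i < d) rho ^+ 2)).
  apply: ler_sum => i _; rewrite -real_normK ?num_real// ler_pXn2r ?nnegrE ?(ltW rho0)//.
  exact/ltW/xc.
rewrite sumr_const card_ord -mulr_natl.
apply: (@lt_le_trans _ _ (d%:R ^+ 2 * (2 * rho) ^+ 2)).
  rewrite (exprMn _ 2 rho) [ltRHS]mulrA ltr_pM2r ?exprn_gt0// !expr2; nra.
rewrite -exprMn le_eqVlt; apply/orP; left; apply/eqP; congr (_ ^+ 2).
by rewrite /rho; field; rewrite gt_eqF// (lt_le_trans ltr01).
Qed.

(** The circumscribed cube has measure [(2 * r) ^ d], the inscribed one [(r / d) ^ d]; the constant
    [(2 * d) ^ d] serves for both. *)
Lemma edist_regular : (0 < d)%N ->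
  regular_quasi_metric (@lebesgue_measure_Rd R d) edist d%:R ((2 * d%:R) ^+ d).
Proof.
move=> d0; have dR : 1 <= d%:R :> R by rewrite ler1n.
have dR0 : 0 < d%:R :> R by rewrite ltr0n.
split => //.
- by rewrite exprn_gt0// mulr_gt0.
- exact: edist_ge0.
- exact: edist_sym.
- exact: edist_quasi_triangle.
- exact: measurable_edist.
- move=> y r r0; apply: (@le_trans _ _ (lebesgue_measure_Rd (cube y r))).
    apply: le_measure; rewrite ?inE.
    + exact: measurable_eball.
    + exact: measurable_cube.
    + exact: eball_sub_cube.
  rewrite lebesgue_measure_cube// lee_fin powR_mulrn ?(ltW r0)// exprMn.
  rewrite ler_wpM2r ?exprn_ge0 ?(ltW r0)// ler_pXn2r ?nnegrE ?mulr_ge0//.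
  by rewrite ler_peMr.
- move=> y r r0; apply: (@le_trans _ _ (lebesgue_measure_Rd (cube y (r / (2 * d%:R))))).
    rewrite lebesgue_measure_cube ?divr_gt0 ?mulr_gt0// lee_fin powR_mulrn ?(ltW r0)//.
    rewrite -exprVn -exprMn ler_pXn2r ?nnegrE ?mulr_ge0 ?invr_ge0 ?(ltW r0)//.
    rewrite mulrC mulrA ler_pM2r ?invr_gt0 ?mulr_gt0//. lra.
  apply: le_measure; rewrite ?inE.
  + exact: measurable_cube.
  + exact: measurable_eball.
  + exact: cube_sub_eball.
Qed.

End euclidean.

(** * Amalgam norms expressed through masses *)

Section amalgam_norm.
Context {disp} {T : measurableType disp} {R : realType}.
Variables (mu : {sigma_finite_measure set T -> \bar R}) (D : T -> T -> R).
Implicit Types (h : T -> R) (f : T -> \bar R) (p : \bar R) (q r k b : R).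
Local Open Scope ereal_scope.

(** Stated for arbitrary [f], by homogeneity of the lower integral, since it is applied to a product
    that contains the Riesz potential. *)
Lemma LnormZ p k f : (0 < k)%R -> 0 < p ->
  Lnorm mu p (fun x => k%:E * f x) = k%:E * Lnorm mu p f.
Proof.
move=> k0; rewrite unlock; case: p => [a a0|_|//]; last first.
  case: ifPn => _; last by rewrite mule0.
  rewrite -(ess_sup_pZl _ _ k0); congr ess_sup; apply/funext => x /=.
  by rewrite abseM gee0_abs// lee_fin ltW.
rewrite lte_fin in a0; under eq_integral do rewrite abseM gee0_abs ?lee_fin ?(ltW k0)//
  poweRM ?lee_fin ?(ltW k0)// poweR_EFin.
rewrite lower_integralZl ?powR_gt0//; last by move=> x; exact: poweR_ge0.
rewrite poweRM ?lee_fin ?powR_ge0//; last by apply: integral_ge0 => x _; exact: poweR_ge0.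
by rewrite poweR_EFin -powRrM divff ?gt_eqF// powRr1// ltW.
Qed.

(** The abstract form of [local_norm], to which it reduces by conversion for the Euclidean distance
    and [h] the modulus of a complex function. *)
Definition amalgam_norm (q p : \bar R) r h : \bar R :=
  Lnorm mu p (fun y => Lnorm mu q (fun x => (h x * \1_(qball D y r) x)%:E)).

Lemma amalgam_normZ (q p : \bar R) r k h : (0 < k)%R -> 0 < q -> 0 < p ->
  amalgam_norm q p r (fun x => k * h x)%R = k%:E * amalgam_norm q p r h.
Proof.
move=> k0 q0 p0; rewrite /amalgam_norm -LnormZ//; apply: eq_Lnorm => y.
by rewrite -LnormZ//; apply: eq_Lnorm => x; rewrite -EFinM mulrA.
Qed.

Lemma amalgam_inner q r h y : (0 < q)%R -> (forall x, 0 <= h x)%R ->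
  Lnorm mu q%:E (fun x => (h x * \1_(qball D y r) x)%:E) =
    mass mu D (fun x => h x `^ q)%R y r `^ q^-1.
Proof.
move=> q0 h0; rewrite unlock; congr (_ `^ _); apply: eq_integral => x _.
rewrite gee0_abs ?lee_fin ?mulr_ge0// poweR_EFin indicE; case: (_ \in _); rewrite ?mulr1//.
by rewrite !mulr0 powR0// gt_eqF.
Qed.

Lemma amalgam_norm_finite_le q (p r : R) h b : (0 < q)%R -> (0 < p)%R -> (0 <= b)%R ->
  (forall x, 0 <= h x)%R ->
  (amalgam_norm q%:E p%:E r h <= b%:E) =
  (\int[mu]_y (mass mu D (fun x => h x `^ q)%R y r `^ (p / q)) <= (b `^ p)%:E).
Proof.
move=> q0 p0 b0 h0; rewrite /amalgam_norm.
under eq_Lnorm do rewrite amalgam_inner//.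
rewrite unlock; under eq_integral do rewrite gee0_abs ?poweR_ge0// -poweRrM mulrC.
set I := (\int[mu]_y _); have I0 : 0 <= I by apply: integral_ge0 => y _; exact: poweR_ge0.
apply/idP/idP => [Ib|Ib].
  have -> : I = (I `^ p^-1) `^ p by rewrite -poweRrM mulVf ?gt_eqF// poweRe1.
  rewrite -poweR_EFin; apply: gt0_ler_poweR => //; first exact: ltW.
  - by rewrite in_itv/= poweR_ge0 leey.
  - by rewrite in_itv/= lee_fin b0 leey.
have -> : b = ((b `^ p) `^ p^-1)%R by rewrite -powRrM mulfV ?gt_eqF// powRr1.
rewrite -poweR_EFin; apply: gt0_ler_poweR => //; first by rewrite invr_ge0 ltW.
- by rewrite in_itv/= I0 leey.
- by rewrite in_itv/= lee_fin powR_ge0 leey.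
Qed.

Lemma amalgam_norm_infinite_le q r h b : (0 < q)%R -> (0 <= b)%R -> 0 < mu [set: T] ->
  (forall x, 0 <= h x)%R ->
  (amalgam_norm q%:E +oo r h <= b%:E) <->
  {ae mu, forall y, mass mu D (fun x => h x `^ q)%R y r <= (b `^ q)%:E}.
Proof.
move=> q0 b0 mu0 h0; rewrite /amalgam_norm.
under eq_Lnorm do rewrite amalgam_inner//.
(* The norm with infinite exponent is zero by definition on a space of measure zero, so positivity
   of the measure selects the essential supremum. *)
rewrite unlock mu0; have m0 y : 0 <= mass mu D (fun x => h x `^ q)%R y r.
  by apply: mass_ge0 => x; exact: powR_ge0.
have E y : (`|mass mu D (fun x => h x `^ q)%R y r `^ q^-1| <= b%:E) =
    (mass mu D (fun x => h x `^ q)%R y r <= (b `^ q)%:E).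
  rewrite gee0_abs ?poweR_ge0//; apply/idP/idP => [Ib|Ib].
    have -> : mass mu D (fun x => h x `^ q)%R y r =
        (mass mu D (fun x => h x `^ q)%R y r `^ q^-1) `^ q.
      by rewrite -poweRrM mulVf ?gt_eqF// poweRe1.
    rewrite -poweR_EFin; apply: gt0_ler_poweR => //; first exact: ltW.
    - by rewrite in_itv/= poweR_ge0 leey.
    - by rewrite in_itv/= lee_fin b0 leey.
  have -> : b = ((b `^ q) `^ q^-1)%R by rewrite -powRrM mulfV ?gt_eqF// powRr1.
  rewrite -poweR_EFin; apply: gt0_ler_poweR => //; first by rewrite invr_ge0 ltW.
  - by rewrite in_itv/= m0 leey.
  - by rewrite in_itv/= lee_fin powR_ge0 leey.
split=> [/ess_supP|] h1; last apply/ess_supP; apply: filterS h1 => y /=; by rewrite E.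
Qed.

End amalgam_norm.

(** * The estimate for normalised functions, for all p *)

Section amalgam_olsen.
Context {disp} {T : measurableType disp} {R : realType}.
Variables (mu : {sigma_finite_measure set T -> \bar R}) (D : T -> T -> R) (e c : R).
Hypothesis qm : regular_quasi_metric mu D e c.
Variables (gamma beta q : R).
Hypotheses (gamma_gt0 : 0 < gamma) (gamma_lt : gamma < e) (beta_lt : beta < - gamma)
  (q_gt1 : 1 < q).
Variables (phi : R -> R) (Cp Cd Ci : R).
Hypotheses (phi_gt0 : forall r, 0 < r -> 0 < phi r) (Cp_gt0 : 0 < Cp) (Cd_gt0 : 0 < Cd)
  (Ci_gt0 : 0 < Ci) (phi_le : forall r, 0 < r -> phi r <= Cp * r `^ beta).
Variable p : \bar R.
Hypothesis le_qp : (q%:E <= p)%E.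

Local Notation th := (olsen_theta gamma beta).
Local Notation amalgam_norm := (amalgam_norm mu D).

Local Notation psi r := (phi r * r `^ (e * recip p)).
Local Notation Phi r := (phi r * r `^ (e * recip q%:E + e * recip p)).

Hypotheses (psi_dec : forall r s, 0 < r -> r <= s -> psi s <= Cd * psi r)
  (psi_int : forall r, 0 < r ->
    (\int[lebesgue_measure]_(t in `[r, +oo[) (psi t `^ q * t^-1)%:E
      <= (Ci * psi r `^ q)%:E)%E).

Let q_gt0 : 0 < q. Proof. exact: lt_trans q_gt1. Qed.

(** The bound on [w] is [Phi ^ th] because [1 / s + 1 / l = th * (1 / q + 1 / p)]. The constant is
    the root, of order [p] or [q], of the one for the powers. *)
Lemma amalgam_olsen : exists2 K, 0 < K & forall g w j : T -> R,
  measurable_fun [set: T] g -> (forall x, 0 <= g x) ->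
  measurable_fun [set: T] w -> (forall x, 0 <= w x) ->
  (forall x, 0 <= j x) -> (forall x, ((j x)%:E <= potential mu D e gamma g x)%E) ->
  (forall r, 0 < r -> (amalgam_norm q%:E p r g <= (Phi r)%:E)%E) ->
  (forall r, 0 < r -> (amalgam_norm (q / th)%:E (th^-1%:E * p) r w <= (Phi r `^ th)%:E)%E) ->
  forall r, 0 < r -> (amalgam_norm q%:E p r (fun x => w x * j x)%R <= (K * Phi r)%:E)%E.
Proof.
have th0 : 0 < th by exact: olsen_theta_gt0.
have s0 : 0 < q / th by rewrite divr_gt0.
have Phi0 r : 0 < r -> 0 < Phi r by move=> r0; rewrite mulr_gt0 ?powR_gt0 ?phi_gt0.
case: p le_qp psi_dec psi_int Phi0 => [p0|_|//].
  rewrite lee_fin => qp0 psi_dec' psi_int' Phi0.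
  have p00 : 0 < p0 := lt_le_trans q_gt0 qp0.
  have recE (a : R) : recip a%:E = a^-1 by rewrite /recip fine_invr.
  rewrite !recE in psi_dec' psi_int' Phi0 *.
  have [K K0 main] := global_olsen_finite qm gamma_gt0 gamma_lt beta_lt q_gt1 phi_gt0
    Cp_gt0 phi_le qp0 Cd_gt0 Ci_gt0 psi_dec' psi_int'.
  exists (K `^ p0^-1); first by rewrite powR_gt0.
  move=> g w j mg g0 mw w0 j0 jle gb wb r r0.
  have wj0 x : 0 <= w x * j x by rewrite mulr_ge0.
  have KP0 : 0 <= K `^ p0^-1 * (phi r * r `^ (e / q + e / p0)).
    by rewrite mulr_ge0 ?powR_ge0 ?(ltW (Phi0 r r0)).
  rewrite amalgam_norm_finite_le//.
  rewrite (powRM _ (powR_ge0 _ _) (ltW (Phi0 r r0))) powRrV ?gt_eqF ?(ltW K0)//.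
  apply: (main g w j) => // u u0.
    by have := gb u u0; rewrite amalgam_norm_finite_le// ltW// Phi0.
  have := wb u u0; rewrite -EFinM amalgam_norm_finite_le ?powR_ge0//; last first.
    by rewrite mulr_gt0// invr_gt0.
  rewrite -powRrM mulrA divff ?gt_eqF// mul1r.
  have -> // : th^-1 * p0 / (q / th) = p0 / q by field; rewrite !gt_eqF.
move=> psi_dec' _ Phi0.
have rec0 : recip (+oo : \bar R)%E = 0 by rewrite /recip invey.
have recE : recip q%:E = q^-1 by rewrite /recip fine_invr.
rewrite recE rec0 mulr0 addr0 in psi_dec' Phi0 *.
have dec r s : 0 < r -> r <= s -> phi s <= Cd * phi r.
  by move=> r0 rs; have := psi_dec' r s r0 rs; rewrite !powRr0 !mulr1.
have mu0 : (0 < mu [set: T])%E.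
  apply: (@lt_le_trans _ _ (mu (qball D point 1))).
    apply: lt_le_trans (qm_ball_ge qm point ltr01).
    by rewrite powR1 mulr1 lte_fin invr_gt0 (qm_cst_gt0 qm).
  by apply: le_measure; rewrite ?inE//; exact: (measurable_qball qm).
have [K K0 main] := global_olsen_infinite qm gamma_gt0 gamma_lt beta_lt q_gt1 phi_gt0 Cp_gt0
  Cd_gt0 phi_le dec.
exists (K `^ q^-1); first by rewrite powR_gt0.
move=> g w j mg g0 mw w0 j0 jle gb wb r r0.
have wj0 x : 0 <= w x * j x by rewrite mulr_ge0.
have KP0 : 0 <= K `^ q^-1 * (phi r * r `^ (e / q)).
  by rewrite mulr_ge0 ?powR_ge0 ?(ltW (Phi0 r r0)).
apply/amalgam_norm_infinite_le => //.
rewrite (powRM _ (powR_ge0 _ _) (ltW (Phi0 r r0))) powRrV ?gt_eqF ?(ltW K0)//.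
apply: (main g w j) => // u u0.
  by apply/(amalgam_norm_infinite_le D _ q_gt0) => //; [exact: ltW (Phi0 u u0)|exact: gb].
have := wb u u0; rewrite gt0_muley ?lte_fin ?invr_gt0//.
move=> /(amalgam_norm_infinite_le D _ s0 (powR_ge0 _ _) mu0 w0).
by rewrite -powRrM mulrCA divff ?gt_eqF// mulr1.
Qed.

End amalgam_olsen.

(** * Fofana norms *)

Section fofana.
Context {R : realType} {d : nat}.
Implicit Types (f : Rd R d -> R[i]) (x y : Rd R d) (phi : R -> R) (q p : \bar R).

Local Notation mu := (@lebesgue_measure_Rd R d).
Local Notation edist := (@Defs.edist R d).
Local Notation normc f := (fun x => Normc.normc (f x)).

Lemma normc_ge0 (z : R[i]) : 0 <= Normc.normc z.
Proof. by case: z => a b; exact: sqrtr_ge0. Qed.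

Lemma normc_Re (z : R[i]) : `|complex.Re z| <= Normc.normc z.
Proof.
case: z => a b /=; rewrite -sqrtr_sqr ler_wsqrtr// lerDl; exact: sqr_ge0.
Qed.

Lemma normc_Im (z : R[i]) : `|complex.Im z| <= Normc.normc z.
Proof.
case: z => a b /=; rewrite -sqrtr_sqr ler_wsqrtr// lerDr; exact: sqr_ge0.
Qed.

Lemma normc_le (z : R[i]) : Normc.normc z <= `|complex.Re z| + `|complex.Im z|.
Proof.
case: z => a b /=; rewrite -(@ler_pXn2r _ 2) ?nnegrE ?sqrtr_ge0 ?addr_ge0//.
rewrite sqr_sqrtr ?addr_ge0 ?sqr_ge0// sqrrD !real_normK ?num_real//.
by rewrite addrAC lerDl mulrn_wge0// mulr_ge0.
Qed.

Lemma measurable_normc f : L0 f -> measurable_fun [set: Rd R d] (normc f).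
Proof.
move=> [mRe mIm].
rewrite (_ : (fun x => _) =
    (fun x => ((complex.Re (f x)) ^+ 2 + (complex.Im (f x)) ^+ 2) `^ 2^-1)); last first.
  apply/funext => x; rewrite powR12_sqrt ?addr_ge0 ?sqr_ge0//.
  by case: (f x).
apply: (measurableT_comp (measurable_powR _)); apply: measurable_funD.
  exact: measurable_funX.
exact: measurable_funX.
Qed.

(** If the integral [P] of [F] is infinite there is nothing to prove. Otherwise the positive and the
    negative part of [u] have integrals between 0 and [P], so their difference is at most [P] in
    absolute value. *)
Lemma Rintegral_norm_le {disp} {T : measurableType disp}
    (nu : {measure set T -> \bar R}) (u F : T -> R) : (forall t, `|u t| <= F t) ->
  ((`|\int[nu]_(t in [set: T]) u t|)%:E <= \int[nu]_t (F t)%:E)%E.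
Proof.
move=> uF; set P := (\int[nu]_t (F t)%:E)%E.
have [->|Poo] := eqVneq P +oo%E; first by rewrite leey.
rewrite /Rintegral integralE.
set A := (\int[nu]_x _)%E; set B := (\int[nu]_x _)%E.
have A0 : (0 <= A)%E by exact: integral_ge0.
have B0 : (0 <= B)%E by exact: integral_ge0.
have AP : (A <= P)%E.
  apply: le_lower_integral => t _; first exact: funepos_ge0.
  rewrite funeposE -EFin_max lee_fin ge_max (le_trans (ler_norm _) (uF t))/=.
  exact: le_trans (uF t).
have BP : (B <= P)%E.
  apply: le_lower_integral => t _; first exact: funeneg_ge0.
  rewrite funenegE -EFinN -EFin_max lee_fin ge_max.
  by rewrite (le_trans _ (uF t)) ?(le_trans _ (uF t))// -normrN ler_norm.
have Pfin : P \is a fin_num by rewrite ge0_fin_numE ?ltey// (le_trans A0).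
have Afin : A \is a fin_num by rewrite ge0_fin_numE// (le_lt_trans AP)// ltey.
have Bfin : B \is a fin_num by rewrite ge0_fin_numE// (le_lt_trans BP)// ltey.
rewrite -(fineK Pfin) lee_fin fineB// ler_distl.
have := fine_ge0 A0; have := fine_ge0 B0.
have := fine_le Afin Pfin AP; have := fine_le Bfin Pfin BP.
by move=> ? ? ? ?; apply/andP; split; lra.
Qed.

(** The factor 2 comes from treating real and imaginary parts separately. Where the integral does
    not converge absolutely the right side is infinite, so the meaningless value there does no
    harm. *)
Lemma riesz_potential_le gamma f x :
  ((Normc.normc (riesz_potential gamma f x))%:E <=
    2%:E * potential mu edist d%:R gamma (normc f) x)%E.
Proof.
rewrite mule_natl mule2n; set P := potential _ _ _ _ _ _.
have le_part (h : R[i] -> R) : (forall z, `|h z| <= Normc.normc z) ->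
    ((`|\int[mu]_(y in [set: Rd R d]) (h (f y) / edist x y `^ (d%:R - gamma))|)%:E <= P)%E.
  move=> hn; apply: Rintegral_norm_le => y.
  rewrite normrM normfV (ger0_norm (powR_ge0 _ _)) -powRN opprB mulrC edist_sym.
  by rewrite ler_wpM2l ?powR_ge0.
apply: (@le_trans _ _ ((`|complex.Re (riesz_potential gamma f x)|)%:E +
   (`|complex.Im (riesz_potential gamma f x)|)%:E)%E).
  by rewrite -EFinD lee_fin normc_le.
by apply: leeD; [exact: (le_part (@complex.Re R) normc_Re)|
  exact: (le_part (@complex.Im R) normc_Im)].
Qed.

Lemma fofana_norm_le q p phi f (X : R) : (forall r, 0 < r -> 0 < phi r) ->
  (fofana_norm q p phi f <= X%:E)%E <->
  forall r, 0 < r -> (amalgam_norm mu edist q p r (normc f) <=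
    (X * (phi r * r `^ (d%:R * recip q + d%:R * recip p)))%:E)%E.
Proof.
move=> phi0.
have E r : 0 < r -> (phi r)^-1 * r `^ (d%:R * (- recip q - recip p)) =
    (phi r * r `^ (d%:R * recip q + d%:R * recip p))^-1.
  by move=> r0; rewrite invfM -powRN; congr (_ * _ `^ _); ring.
have P r : 0 < r -> 0 < phi r * r `^ (d%:R * recip q + d%:R * recip p).
  by move=> r0; rewrite mulr_gt0 ?powR_gt0 ?phi0.
split=> [h r r0|h].
  have : (((phi r)^-1 * r `^ (d%:R * (- recip q - recip p)))%:E * local_norm q p r f
      <= X%:E)%E.
    by apply: le_trans h; apply: ereal_sup_ubound; exists r.
  by rewrite E// lee_pdivrMl ?P// -EFinM mulrC.
apply: ge_ereal_sup => _ [r r0 <-]; rewrite E//.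
by rewrite lee_pdivrMl ?P// -EFinM mulrC; exact: h.
Qed.

Lemma fofana_norm_ge0 q p phi f : (forall r, 0 < r -> 0 < phi r) ->
  (0 <= fofana_norm q p phi f)%E.
Proof.
move=> phi0; apply: (@le_trans _ _ (((phi 1)^-1 * 1 `^ (d%:R * (- recip q - recip p)))%:E
  * local_norm q p 1 f)%E).
  by rewrite mule_ge0 ?Lnorm_ge0// lee_fin mulr_ge0 ?powR_ge0// invr_ge0 ltW// phi0.
by apply: ereal_sup_ubound; exists 1 => //=.
Qed.

End fofana.

(** The norms of [W] and [f] may be zero, so functions are divided by numbers strictly above the
    norms, and these are then let down to the norms. *)
Lemma le_mul_of_gt {R : realType} (x : \bar R) (K a b : R) : 0 <= K -> 0 <= a -> 0 <= b ->
  (forall u v, a < u -> b < v -> (x <= (K * u * v)%:E)%E) -> (x <= (K * a * b)%:E)%E.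
Proof.
move=> K0 a0 b0 h; apply/lee_addgt0Pr => eps eps0.
(* Raising both factors by [t <= 1] adds [t * (K * (a + b + t))], which is at most [t * M]; the
   final 1 keeps [M] positive. *)
pose M := K * (a + b + 1) + 1.
have M0 : 0 < M by rewrite ltr_wpDl// mulr_ge0// !addr_ge0.
pose t := Num.min 1 (eps / M).
have t0 : 0 < t by rewrite lt_min ltr01 divr_gt0.
have t1 : t <= 1 by rewrite ge_min lexx.
have tM : t * M <= eps by rewrite -ler_pdivlMr// ge_min lexx orbT.
apply: le_trans (h (a + t) (b + t) _ _) _; rewrite ?ltrDl// -EFinD lee_fin.
have -> : K * (a + t) * (b + t) = K * a * b + t * (K * (a + b + t)) by ring.
rewrite lerD2l; apply: le_trans tM; rewrite ler_wpM2l ?(ltW t0)// /M.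
by apply: (@le_trans _ _ (K * (a + b + 1))); rewrite ?lerDl// ler_wpM2l// lerD2l.
Qed.

Theorem theorem5p1 (R : realType) (d : nat) (q : R) (p : \bar R)
    (gamma beta : R) (phi : R -> R)
    (q_gt1 : 1 < q) (le_qp : (q%:E <= p)%E)
    (gamma_gt0 : 0 < gamma) (gamma_lt : gamma < d%:R / q)
    (beta_ge : - (d%:R / q) <= beta) (beta_lt : beta < - gamma)
    (phiG : classG d q%:E p phi)
    (phi_int : exists2 C : R, 0 < C & forall r : R, 0 < r ->
      (\int[lebesgue_measure]_(t in `[r, +oo[)
          (phi t `^ q * t `^ (d%:R * q * recip p - 1))%:E
        <= (C * (phi r `^ q * r `^ (d%:R * q * recip p)))%:E)%E)
    (phi_le : exists2 C' : R, 0 < C' & forall r : R, 0 < r ->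
      phi r <= C' * r `^ beta) :
  let s : R := - (beta * q / gamma) in
  let l : \bar R := ((- (beta / gamma))%:E * p)%E in
  let phis : R -> R := fun r => phi r `^ (q / s) in
  exists2 K : R, 0 < K &
    forall W f : Rd R d -> R[i],
      fofana_space s%:E l phis W ->
      fofana_space q%:E p phi f ->
      (fofana_norm q%:E p phi (W \* riesz_potential gamma f)%R
        <= K%:E * fofana_norm s%:E l phis W
             * fofana_norm q%:E p phi f)%E.
Proof.
have q0 : 0 < q := lt_trans ltr01 q_gt1.
have beta0 : beta < 0 by apply: lt_trans beta_lt _; rewrite oppr_lt0.
have d0 : (0 < d)%N.
  rewrite lt0n; apply/negP => /eqP d0.
  by move: gamma_lt; rewrite d0 mul0r ltNge (ltW gamma_gt0).
have gamma_ltd : gamma < d%:R.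
  by apply: (lt_le_trans gamma_lt); rewrite ler_pdivrMr// ler_peMr// ltW.
have qm := @edist_regular R d d0.
have p0 : (0 < p)%E by apply: lt_le_trans le_qp; rewrite lte_fin.
have [phi_gt0 [Cd Cd0 dec] _] := phiG.
have [Ci Ci0 phi_int'] := phi_int; have [Cp Cp0 phi_le'] := phi_le.
pose th := olsen_theta gamma beta.
have th0 : 0 < th by exact: olsen_theta_gt0.
have psi_int r : 0 < r -> (\int[lebesgue_measure]_(t in `[r, +oo[)
    ((phi t * t `^ (d%:R * recip p)) `^ q * t^-1)%:E
      <= (Ci * (phi r * r `^ (d%:R * recip p)) `^ q)%:E)%E.
  move=> r0; have E t : 0 < t -> (phi t * t `^ (d%:R * recip p)) `^ q =
      phi t `^ q * t `^ (d%:R * q * recip p).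
    move=> t0; rewrite (powRM _ (ltW (phi_gt0 t t0)) (powR_ge0 _ _)) -powRrM.
    by congr (_ * _ `^ _); ring.
  rewrite E//; apply: le_trans (phi_int' r r0); rewrite le_eqVlt; apply/orP; left; apply/eqP.
  apply: eq_integral => t; rewrite inE /= in_itv/= andbT => rt.
  have t0 := lt_le_trans r0 rt.
  by rewrite E// -mulrA -(powR_inv1 (ltW t0)) -powRD_gt0.
have [K K0 main] := amalgam_olsen qm gamma_gt0 gamma_ltd beta_lt q_gt1 phi_gt0 Cp0 Cd0 Ci0
  phi_le' le_qp dec psi_int.
have sE : - (beta * q / gamma) = q / th.
  by rewrite /th /olsen_theta; field; rewrite ?(lt_eqF beta0) ?(gt_eqF gamma_gt0).
have lE : - (beta / gamma) = th^-1.
  by rewrite /th /olsen_theta; field; rewrite ?(lt_eqF beta0) ?(gt_eqF gamma_gt0).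
rewrite sE lE => s l phis.
have phisE r : phis r = phi r `^ th.
  by rewrite /phis /s invf_div mulrCA divff ?mulr1// gt_eqF.
have phis_gt0 r : 0 < r -> 0 < phis r by move=> r0; rewrite powR_gt0 ?phi_gt0.
have recs : recip s%:E = th * recip q%:E.
  by rewrite /recip !fine_invr /s invf_div.
have recl : recip l = th * recip p.
  rewrite /l; case: (p) p0 => [a a0|_|//].
    by rewrite -EFinM /recip !fine_invr invfM invrK.
  by rewrite gt0_muley ?lte_fin ?invr_gt0// /recip invey mulr0.
exists (2 * K); first by rewrite mulr_gt0.
move=> W f [L0W Wfin] [L0f ffin].
have a0 := fofana_norm_ge0 s%:E l W phis_gt0; have b0 := fofana_norm_ge0 q%:E p f phi_gt0.
have Wn : fofana_norm s%:E l phis W \is a fin_num by rewrite ge0_fin_numE.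
have fn : fofana_norm q%:E p phi f \is a fin_num by rewrite ge0_fin_numE.
rewrite -(fineK Wn) -(fineK fn) -!EFinM.
apply: le_mul_of_gt; rewrite ?mulr_ge0 ?fine_ge0 ?(ltW K0)// => w0 N Ww fN.
have w00 : 0 < w0 by apply: le_lt_trans Ww; exact: fine_ge0.
have N0 : 0 < N by apply: le_lt_trans fN; exact: fine_ge0.
apply/(fofana_norm_le _ _ _ _ phi_gt0) => r r0.
have /(fofana_norm_le _ _ _ _ phis_gt0) Wb : (fofana_norm s%:E l phis W <= w0%:E)%E.
  by rewrite -(fineK Wn) lee_fin ltW.
have /(fofana_norm_le _ _ _ _ phi_gt0) fb : (fofana_norm q%:E p phi f <= N%:E)%E.
  by rewrite -(fineK fn) lee_fin ltW.
pose g x := N^-1 * Normc.normc (f x).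
pose w x := w0^-1 * Normc.normc (W x).
(* The factor 2 absorbs the one in [riesz_potential_le], so that [j] lies below the potential of
   [g]; it reappears in the constant [2 * K]. *)
pose j x := (2 * N)^-1 * Normc.normc (riesz_potential gamma f x).
have N20 : 0 < 2 * N by rewrite mulr_gt0.
have g0 x : 0 <= g x by rewrite mulr_ge0 ?normc_ge0// invr_ge0 ltW.
have w_ge0 x : 0 <= w x by rewrite mulr_ge0 ?normc_ge0// invr_ge0 ltW.
have j0 x : 0 <= j x by rewrite mulr_ge0 ?normc_ge0// invr_ge0 ltW.
have mg : measurable_fun [set: Rd R d] g.
  exact: (measurable_funM (measurable_cst _) (measurable_normc L0f)).
have mw : measurable_fun [set: Rd R d] w.
  exact: (measurable_funM (measurable_cst _) (measurable_normc L0W)).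
have jg x : ((j x)%:E <= potential (@lebesgue_measure_Rd R d) (@Defs.edist R d) d%:R gamma g x)%E.
  have -> : potential (@lebesgue_measure_Rd R d) (@Defs.edist R d) d%:R gamma g x =
      ((N^-1)%:E * potential (@lebesgue_measure_Rd R d) (@Defs.edist R d) d%:R gamma
        (fun x => Normc.normc (f x)) x)%E.
    rewrite /potential -lower_integralZl ?invr_gt0//.
      by apply: eq_integral => z _; rewrite -EFinM mulrCA.
    by move=> z; rewrite lee_fin mulr_ge0 ?powR_ge0 ?normc_ge0.
  rewrite /j invfM EFinM; apply: le_trans (lee_wpmul2l _ (riesz_potential_le gamma f x)) _.
    by rewrite lee_fin mulr_ge0// invr_ge0 ltW.
  by rewrite muleA -EFinM mulrAC mulVf// mul1r.
have s0 : (0 < s%:E)%E by rewrite lte_fin divr_gt0.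
have q0e : (0 < q%:E)%E by rewrite lte_fin.
have l0 : (0 < l)%E by rewrite mule_gt0// lte_fin invr_gt0.
have Phi0 u : 0 < u -> 0 < phi u * u `^ (d%:R * recip q%:E + d%:R * recip p).
  by move=> u0; rewrite mulr_gt0 ?powR_gt0 ?phi_gt0.
have -> : amalgam_norm (@lebesgue_measure_Rd R d) (@Defs.edist R d) q%:E p r
    (fun x => Normc.normc ((W \* riesz_potential gamma f) x)) =
  ((2 * w0 * N)%:E * amalgam_norm (@lebesgue_measure_Rd R d) (@Defs.edist R d) q%:E p r
    (fun x => w x * j x)%R)%E.
  rewrite -amalgam_normZ//; last by rewrite !mulr_gt0.
  congr amalgam_norm; apply/funext => x; rewrite /= Normc.normcM /w /j; field.
  by rewrite !gt_eqF.
apply: le_trans (lee_wpmul2l _ (main g w j mg g0 mw w_ge0 j0 jg _ _ r r0)) _.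
- by rewrite lee_fin !mulr_ge0 ?(ltW w00) ?(ltW N0).
- move=> u u0; rewrite amalgam_normZ ?invr_gt0//.
  by rewrite lee_pdivrMl// -EFinM; exact: fb.
- move=> u u0; rewrite amalgam_normZ ?invr_gt0// lee_pdivrMl// -EFinM.
  (* The function [phis] and the reciprocals of [s] and [l] all carry [th], so the bound for [W] is
     the power [th] of the bound for [f]. *)
  have := Wb u u0; rewrite phisE recs recl.
  rewrite (powRM _ (ltW (phi_gt0 u u0)) (powR_ge0 _ _)) -powRrM.
  by have -> // : d%:R * (th * recip q%:E) + d%:R * (th * recip p) =
    (d%:R * recip q%:E + d%:R * recip p) * th by ring.
by rewrite -EFinM lee_fin le_eqVlt; apply/orP; left; apply/eqP; ring.
Qed.
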